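(* Let $A,B\ge0$ and write $\nabla^+_xf(x)=f(x+1)-f(x)$, always acting on the first variable of the kernel. (i) (Bounded interval.) There is a constant $C>0$, not depending on $\varepsilon$, such that for all sufficiently large $N$, with $\varepsilon=1/N$, $\mu_A=1-\varepsilon A$, $\mu_B=1-\varepsilon B$, the Robin heat kernel $\mathbf p^R$ on $\{0,1,\dots,N\}$ satisfies $$\sum_{y=0}^N\int_0^\infty\nabla^+_x\mathbf p^R_t(x,y)\,\nabla^+_x\mathbf p^R_t(\bar x,y)\,dt=\mathbf 1_{x=\bar x}(1-c)-\mathbf 1_{x\ne\bar x}\,c$$ for all $x,\bar x\in\{0,\dots,N-1\}$, where the constant $c$ is independent of $x,\bar x$ and satisfies $0\le c\le C\varepsilon$; moreover $c=0$ if $\mu_A=1$ or $\mu_B=1$. (ii) (Half line.) For $\mu_A=1-\varepsilon A$ with $\varepsilon>0$ small, the Robin heat kernel $\mathbf p^R$ on $\mathbb Z_{\ge0}$ satisfies $$\sum_{y=0}^\infty\int_0^\infty\nabla^+_x\mathbf p^R_t(x,y)\,\nabla^+_x\mathbf p^R_t(\bar x,y)\,dt=\mathbf 1_{x=\bar x}\qquad\text{for all }x,\bar x\ge0.$$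
   Context: $\Delta f(x)=f(x-1)-2f(x)+f(x+1)$. The Robin heat kernel $\mathbf p^R_t(x,y)$ on $\{0,\dots,N\}$ with parameters $(\mu_A,\mu_B)$ is the solution, for each $y$, of $\partial_t\mathbf p^R_t(x,y)=\frac12\Delta_x\mathbf p^R_t(x,y)$ for $x\in\{0,\dots,N\}$, $\mathbf p^R_0(x,y)=\mathbf 1_{x=y}$, with the boundary conventions $\mathbf p^R_t(-1,y)=\mu_A\mathbf p^R_t(0,y)$ and $\mathbf p^R_t(N+1,y)=\mu_B\mathbf p^R_t(N,y)$. On $\mathbb Z_{\ge0}$ it is defined in the same way (as the bounded solution) for $x\ge0$ with only the condition $\mathbf p^R_t(-1,y)=\mu_A\mathbf p^R_t(0,y)$. Equivalently, it is the transition probability of the continuous-time walk jumping to each neighbour at rate $\frac12$ which at $0$ (resp. $N$) is killed at rate $(1-\mu_A)/2$ (resp. $(1-\mu_B)/2$) instead of leaving the domain. *)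

(* Defs.v *)
From HB Require Import structures.
From mathcomp Require Import all_boot all_order all_algebra.
From mathcomp Require Import all_classical all_reals all_analysis.

Set Implicit Arguments.
Unset Strict Implicit.
Unset Printing Implicit Defensive.

Import Order.TTheory GRing.Theory Num.Theory.
Import numFieldNormedType.Exports.
Local Open Scope classical_set_scope.
Local Open Scope ring_scope.

Definition laplacian (R : realType) (f : int -> R) (x : int) : R :=
  f (x - 1) - 2 * f x + f (x + 1).

Definition forward_diff (R : realType) (f : int -> R) (x : int) : R :=
  f (x + 1) - f x.

(* Space variables live in [int] so that the ghost sites -1 and N + 1 used by
   the boundary conventions are available.  Values of [p t x y] at negative
   times, or away from the domain and its ghost sites, are unconstrained. *)

(* The time derivative is only required for t > 0, with p right-continuous at
   t = 0. *)
Definition heat_equation_on (R : realType) (D : set int)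
    (p : R -> int -> int -> R) : Prop :=
  forall x y, D x -> D y ->
    [/\ p 0 x y = (x == y)%:R,
        p t x y @[t --> (0 : R)^'+] --> p 0 x y &
        forall t : R, 0 < t ->
          is_derive t 1 (fun s : R => p s x y)
            (2^-1 * laplacian (fun z => p t z y) x)].

Definition segment (N : nat) : set int := [set x | 0 <= x <= N%:Z].

Definition half_line : set int := [set x | 0 <= x].

Definition robin_kernel_segment (R : realType) (N : nat) (muA muB : R)
    (p : R -> int -> int -> R) : Prop :=
  heat_equation_on (segment N) p /\
  forall t y, 0 <= t -> segment N y ->
    p t (- 1) y = muA * p t 0 y /\
    p t (N%:Z + 1) y = muB * p t N%:Z y.

Definition robin_kernel_half_line (R : realType) (muA : R)
    (p : R -> int -> int -> R) : Prop :=
  [/\ heat_equation_on half_line p,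
      forall t y, 0 <= t -> half_line y -> p t (- 1) y = muA * p t 0 y &
      forall y, half_line y -> exists M : R,
        forall t x, 0 <= t -> half_line x -> `|p t x y| <= M].

Definition gradient_product (R : realType) (p : R -> int -> int -> R)
    (x xb y : int) (t : R) : R :=
  forward_diff (fun z => p t z y) x * forward_diff (fun z => p t z y) xb.

(* [Rintegral] returns a junk value on non-integrable functions; statements
   about [gradient_integral] should therefore be paired with this. *)
Definition gradient_integrable (R : realType) (p : R -> int -> int -> R)
    (x xb y : int) : Prop :=
  (@lebesgue_measure R).-integrable `[0, +oo[
    (EFin \o gradient_product p x xb y).

Definition gradient_integral (R : realType) (p : R -> int -> int -> R)
    (x xb y : int) : R :=
  \int[@lebesgue_measure R]_(t in `[0, +oo[) gradient_product p x xb y t.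

(* Main.v *)
(** Let [P_t] be the heat semigroup.  Since [P_t] is symmetric and
    [P_t P_t = P_2t], summing the product of two gradients over [y] gives the
    mixed second difference [q(t)] of [p_2t(x, xb)].  The heat equation makes
    [q] an explicit time derivative, up to the flux [w] killed at the left
    boundary: with [u_t(z) = p_2t(z, xb + 1) - p_2t(z, xb)],
    [q = d/dt (w(xb + 1) - w(xb) + sum_(z <= x) u_t(z))].  As [t] grows [u_t]
    vanishes and [w] tends to a bounded function [W], harmonic away from [0],
    so the total integral is [1_(x = xb)] plus the slope of the affine function
    [W].  On the half line a bounded affine function is constant; on the segment
    the boundary conditions determine the slope, which is [- c].

    Both domains are instances of one nearest-neighbour chain on [nat] with
    conductances [c] and killing rates [k]; the segment has [c = 0] from [N]
    on. *)

Require Import Defs.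
From HB Require Import structures.
From mathcomp Require Import all_boot all_order all_algebra.
From mathcomp Require Import all_classical all_reals all_analysis.
From mathcomp Require Import measurable_realfun ring lra zify.

Set Implicit Arguments.
Unset Strict Implicit.
Unset Printing Implicit Defensive.

Import Order.TTheory GRing.Theory Num.Theory.
Import numFieldNormedType.Exports.
Local Open Scope classical_set_scope.
Local Open Scope ring_scope.

(** * Real functions of one variable *)

(** Beyond the equation and the initial value, only boundedness is given, and that on the half line
    alone: symmetry, the semigroup law, positivity and the bound by 1 must all be extracted from the
    equation. On the half line, summing by parts up to [n] leaves a flux at [n]. Picard iteration
    makes the kernel factorially small far from the diagonal, uniformly on bounded time intervals,
    so this flux vanishes as [n] grows. Large times need another device: the half line has no
    spectral gap, and on a segment without killing the kernel does not even tend to 0. A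
    nonincreasing quantity whose time integral stays bounded is O(1/t). This applies to the diagonal
    Gram entries and to the killing rate on the diagonal at 0; Cauchy-Schwarz then carries the decay
    over to [u_t] and to the rates from other starting points. *)

Lemma cvg_bigsum (R : realType) (T : Type) (F : set_system T) (FF : Filter F)
    (n : nat) (f : nat -> T -> R) (l : nat -> R) :
  (forall i, f i x @[x --> F] --> l i) ->
  \sum_(i < n) f i x @[x --> F] --> \sum_(i < n) l i.
Proof.
move=> fl; elim: n => [|n IHn].
  by under eq_fun do rewrite big_ord0; rewrite big_ord0; exact: cvg_cst.
by under eq_fun do rewrite big_ord_recr; rewrite big_ord_recr; exact: cvgD.
Qed.

Section real_derivatives.
Variable R : realType.
Implicit Types (f g : R -> R) (t a b k : R).

Lemma is_derive_add f g t a b : is_derive t 1 f a -> is_derive t 1 g b ->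
  is_derive t 1 (fun s => f s + g s) (a + b).
Proof. by move=> fa gb; exact: is_deriveD. Qed.

Lemma is_derive_sub f g t a b : is_derive t 1 f a -> is_derive t 1 g b ->
  is_derive t 1 (fun s => f s - g s) (a - b).
Proof. by move=> fa gb; exact: is_deriveB. Qed.

Lemma is_derive_mul f g t a b : is_derive t 1 f a -> is_derive t 1 g b ->
  is_derive t 1 (fun s => f s * g s) (f t * b + g t * a).
Proof. by move=> fa gb; exact: is_deriveM. Qed.

Lemma is_derive_scale f k t a : is_derive t 1 f a ->
  is_derive t 1 (fun s => k * f s) (k * a).
Proof. by move=> fa; exact: is_deriveZ. Qed.

Lemma is_derive_linear k t : is_derive t 1 (fun s : R => k * s) k.
Proof.
by have := is_derive_scale k (is_derive_id t 1); rewrite mulr1.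
Qed.

Lemma is_derive_bigsum (n : nat) (F dF : nat -> R -> R) t :
  (forall i, is_derive t 1 (F i) (dF i t)) ->
  is_derive t 1 (fun s => \sum_(i < n) F i s) (\sum_(i < n) dF i t).
Proof.
move=> FdF; have -> : (fun s => \sum_(i < n) F i s) = \sum_(i < n) F i.
  by apply/funext => s; rewrite fct_sumE.
exact: is_derive_sum.
Qed.

Lemma is_derive_comp_affine f k b t a : is_derive (k * t + b) 1 f a ->
  is_derive t 1 (fun s => f (k * s + b)) (k * a).
Proof.
move=> fa; have dl : is_derive t 1 (fun s : R => k * s + b) k.
  rewrite -[X in is_derive _ _ _ X]addr0.
  exact: (is_derive_add (is_derive_linear k t) (is_derive_cst b t 1)).
rewrite mulrC; exact: (@is_derive1_comp _ f (fun s => k * s + b) t a k fa dl).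
Qed.

Lemma continuous_bigsum (n : nat) (F : nat -> R -> R) :
  (forall i, continuous (F i)) -> continuous (fun s => \sum_(i < n) F i s).
Proof.
move=> cF t; exact: (cvg_bigsum _ (fun i => cF i t)).
Qed.

Lemma continuous_add f g : continuous f -> continuous g ->
  continuous (fun s => f s + g s).
Proof. by move=> cf cg t; apply: cvgD; [exact: cf|exact: cg]. Qed.

Lemma continuous_sub f g : continuous f -> continuous g ->
  continuous (fun s => f s - g s).
Proof. by move=> cf cg t; apply: cvgB; [exact: cf|exact: cg]. Qed.

Lemma continuous_mul f g : continuous f -> continuous g ->
  continuous (fun s => f s * g s).
Proof. by move=> cf cg t; apply: cvgM; [exact: cf|exact: cg]. Qed.

Lemma continuous_cst k : continuous (fun _ : R => k).
Proof. by move=> t; exact: cvg_cst. Qed.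

Lemma continuous_comp_affine f k b : continuous f ->
  continuous (fun s => f (k * s + b)).
Proof.
move=> cf t; apply: (@continuous_comp _ _ _ (fun s => k * s + b) f);
  last exact: cf.
apply: cvgD; last exact: cvg_cst.
by apply: cvgM; [exact: cvg_cst|exact: cvg_id].
Qed.

(** Mean value theorem for [g - f]. The derivatives are required only inside the interval because
    the heat equation holds only at positive times. *)
Lemma increment_le f g (df dg : R -> R) a b :
  a <= b -> continuous f -> continuous g ->
  (forall t, a < t < b -> is_derive t 1 f (df t)) ->
  (forall t, a < t < b -> is_derive t 1 g (dg t)) ->
  (forall t, a < t < b -> df t <= dg t) ->
  f b - f a <= g b - g a.
Proof.
rewrite le_eqVlt => /predU1P[->|ab] cf cg df_ dg_ dfg; first by rewrite !subrr.
have dgf t : t \in `]a, b[%R ->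
    is_derive t 1 (fun s => g s - f s) (dg t - df t).
  by rewrite in_itv /= => tab; exact: (is_derive_sub (dg_ _ tab) (df_ _ tab)).
have [t] := MVT ab dgf (continuous_subspaceT (continuous_sub cg cf)).
rewrite in_itv /= => tab E.
suff : 0 <= (g b - f b) - (g a - f a) by lra.
by rewrite E mulr_ge0 ?subr_ge0 ?dfg// ltW.
Qed.

Lemma increment_le_cst f (df : R -> R) a b k :
  a <= b -> continuous f ->
  (forall t, a < t < b -> is_derive t 1 f (df t)) ->
  (forall t, a < t < b -> df t <= k) ->
  f b - f a <= k * (b - a).
Proof.
move=> ab cf df_ dfk; rewrite mulrBr.
have cl : continuous (fun s : R => k * s).
  by apply: continuous_mul; [exact: continuous_cst|move=> ?; exact: cvg_id].
exact: (increment_le ab cf cl df_ (fun t _ => is_derive_linear k t)).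
Qed.

Lemma increment_norm_le f (df : R -> R) a b k :
  a <= b -> continuous f ->
  (forall t, a < t < b -> is_derive t 1 f (df t)) ->
  (forall t, a < t < b -> `|df t| <= k) ->
  `|f b - f a| <= k * (b - a).
Proof.
move=> ab cf df_ dfk; rewrite ler_norml; apply/andP; split; last first.
  by apply: (increment_le_cst ab cf df_) => t /dfk; apply/le_trans/ler_norm.
rewrite lerNl -[X in X <= _]mulN1r mulrBr.
have cNf : continuous (fun s => -1 * f s).
  by apply: continuous_mul => //; exact: continuous_cst.
apply: (increment_le_cst ab cNf
  (fun t tab => is_derive_scale (-1) (df_ t tab))).
by move=> t /dfk; rewrite mulN1r -normrN; apply/le_trans/ler_norm.
Qed.

Lemma increment_eq0 f (df : R -> R) a b :
  a <= b -> continuous f ->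
  (forall t, a < t < b -> is_derive t 1 f (df t)) ->
  (forall t, a < t < b -> df t = 0) -> f b = f a.
Proof.
move=> ab cf df_ df0; apply/eqP; rewrite -subr_eq0 -normr_le0.
rewrite -(mul0r (b - a)); apply: (increment_norm_le ab cf df_) => t /df0 ->.
by rewrite normr0.
Qed.

(** The kernel is unconstrained at negative times and only right-continuous at 0. Composing with the
    absolute value gives continuity on all of [R], so that the increment lemmas can start at time
    0. *)
Lemma continuous_even_ext f :
  (forall t, 0 < t -> {for t, continuous f}) -> f t @[t --> 0^'+] --> f 0 ->
  continuous (fun t => f `|t|).
Proof.
move=> cf f0 t; have [->|t0] := eqVneq t 0.
  rewrite /continuous_at normr0.
  move/cvgrPdist_le : f0 => f0; apply/cvgrPdist_le => e e0.
  have := f0 _ e0; rewrite near_withinE => f0e.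
  case: f0e => d /= d0 fd; exists d => //= s /=; rewrite sub0r normrN => sd.
  have [->|s0] := eqVneq s 0; first by rewrite normr0 subrr normr0 ltW.
  by apply: fd; rewrite ?normr_gt0//= sub0r normrN normr_id.
have : (f \o Num.norm) x @[x --> t] --> (f \o Num.norm) t.
  apply: continuous_comp; first exact: norm_continuous.
  by apply: cf; rewrite normr_gt0.
by [].
Qed.

Lemma is_derive_even_ext f t a :
  0 < t -> is_derive t 1 f a -> is_derive t 1 (fun s => f `|s|) a.
Proof.
move=> t0; apply: near_eq_is_derive.
near=> s; rewrite ger0_norm//; apply: ltW; near: s; exact: lt_nbhsr.
Unshelve. all: by end_near. Qed.

Lemma continuous_is_primitive f : continuous f ->
  exists2 F : R -> R, continuous F &
    F 0 = 0 /\ forall t, 0 < t -> is_derive t 1 F (f t).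
Proof.
move=> cf.
(* The base point -1 puts 0 inside the interval, so the primitive is continuous there; the even
   extension then gives continuity everywhere. *)
pose F0 x := (\int[@lebesgue_measure R]_(s in `[(-1)%R, x]) f s)%R.
have dF0 t : -1 < t -> is_derive t 1 F0 (f t).
  move=> t1.
  have [] := @continuous_FTC1_closed R f (-1) t (t + 1) _ _ t1 (cf t).
  - by rewrite ltrDl.
  - apply: continuous_compact_integrable; first exact: segment_compact.
    exact: continuous_subspaceT.
  - by move=> dF E; exact: (DeriveDef dF (etrans (esym (derive1E _ _)) E)).
pose F x := F0 x - F0 0.
have dF t : -1 < t -> is_derive t 1 F (f t).
  move=> t1; rewrite -[X in is_derive _ _ _ X]subr0.
  exact: (is_derive_sub (dF0 _ t1) (is_derive_cst _ t 1)).
have cF t : -1 < t -> {for t, continuous F}.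
  move=> /dF[dFt _]; apply: differentiable_continuous.
  exact/derivable1_diffP.
exists (fun t => F `|t|).
  apply: continuous_even_ext => [t t0|]; first by apply: cF; lra.
  by apply: cvg_at_right_filter; apply: cF; lra.
split; first by rewrite normr0 /F subrr.
by move=> t t0; apply: is_derive_even_ext => //; apply: dF; lra.
Qed.

End real_derivatives.

Lemma ler_cvgn_err (R : realType) (f g e : nat -> R) (l l' : R) :
  f n @[n --> \oo] --> l -> g n @[n --> \oo] --> l' -> e n @[n --> \oo] --> 0 ->
  (forall n, f n <= g n + e n) -> l <= l'.
Proof.
move=> fl gl' e0 fge; rewrite -[l']addr0.
have gel : g n + e n @[n --> \oo] --> l' + 0 by exact: cvgD.
by apply: (ler_cvg_to fl gel); exact: nearW.
Qed.

Lemma cvgn_uniq (R : realType) (u : nat -> R) (l l' : R) :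
  u n @[n --> \oo] --> l -> u n @[n --> \oo] --> l' -> l = l'.
Proof.
by move=> /(cvg_lim (@Rhausdorff R)) <- /(cvg_lim (@Rhausdorff R)) <-.
Qed.

(** * Birth-death chains: decaying solutions *)

Section birth_death.
Variables (R : realType) (c k : nat -> R).
Implicit Types s t u T : R.
Hypothesis c01 : forall x, 0 <= c x <= 1.
Hypothesis k01 : forall x, 0 <= k x <= 1.

(** Edge [x] joins [x] and [x.+1]. At [x = 0] the truncated predecessor is 0 itself, so the term of
    the missing left edge vanishes. *)
Definition generator (f : nat -> R) (x : nat) : R :=
  c x * (f x.+1 - f x) - c x.-1 * (f x - f x.-1) - k x * f x.

Lemma generatorB (f g : nat -> R) x :
  generator (fun z => f z - g z) x = generator f x - generator g x.
Proof. by rewrite /generator; ring. Qed.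

(** The generator is symmetric for the counting measure: the killing terms cancel and the inner
    edges telescope. *)
Lemma green_generator (f g : nat -> R) n :
  \sum_(z < n.+1) (f z * generator g z - g z * generator f z) =
  c n * (f n * g n.+1 - g n * f n.+1).
Proof.
rewrite /generator; elim: n => [|n IHn]; first by rewrite big_ord1 /=; ring.
by rewrite big_ord_recr /= IHn; ring.
Qed.

Lemma sum_generator (f : nat -> R) n :
  \sum_(z < n.+1) generator f z =
  c n * (f n.+1 - f n) - \sum_(z < n.+1) k z * f z.
Proof.
rewrite /generator; elim: n => [|n IHn]; first by rewrite !big_ord1 /=; ring.
by rewrite [LHS]big_ord_recr /= IHn [in RHS]big_ord_recr /=; ring.
Qed.

(** Summation by parts; what is discarded are the squares of [f] at the killing sites and of its
    differences along the edges, all with a favourable sign. *)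
Lemma energy_generator (f : nat -> R) n :
  \sum_(z < n.+1) f z * generator f z <= c n * (f n * (f n.+1 - f n)).
Proof.
rewrite /generator; elim: n => [|n IHn].
  rewrite big_ord1 /=; have /andP[k0 _] := k01 0%N.
  by have := mulr_ge0 k0 (sqr_ge0 (f 0%N)); nra.
rewrite big_ord_recr /=; apply: (le_trans (lerD IHn (lexx _))).
have /andP[kn _] := k01 n.+1; have /andP[cn _] := c01 n.
have := mulr_ge0 kn (sqr_ge0 (f n.+1)).
have := mulr_ge0 cn (sqr_ge0 (f n.+1 - f n)).
by nra.
Qed.

(** The three terms are at most [2 * M], [2 * M] and [M]. Half of the rounded constant 6 is the rate
    3 in the off-diagonal bound of the kernel. *)
Lemma generator_norm_le (f : nat -> R) x (M : R) :
  `|f x.+1| <= M -> `|f x| <= M -> `|f x.-1| <= M -> `|generator f x| <= 6 * M.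
Proof.
rewrite !ler_norml => /andP[? ?] /andP[? ?] /andP[? ?].
have /andP[? ?] := c01 x; have /andP[? ?] := c01 x.-1; have /andP[? ?] := k01 x.
rewrite /generator; apply/andP; split; nra.
Qed.

Lemma is_derive_exp_coeff (lam t : R) m :
  is_derive t 1 (fun s => exp_coeff (lam * s) m.+1)
    (lam * exp_coeff (lam * t) m).
Proof.
rewrite /exp_coeff /=.
have -> : (fun s : R => (lam * s) ^+ m.+1 / m.+1`!%:R) =
          (fun s => (lam ^+ m.+1 / m.+1`!%:R) * ((id : R -> R) ^+ m.+1) s).
  by apply/funext => s; rewrite exprMn fctE; ring.
apply: (is_derive_eq (is_derive_scale (lam ^+ m.+1 / m.+1`!%:R)
  (is_deriveX m.+1 (is_derive_id t 1)))).
rewrite factS natrM exprMn exprS /GRing.scale /= mulr1.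
have m0 : 1 + m%:R != 0 :> R by rewrite nat1r pnatr_eq0.
have mf0 : m`!%:R != 0 :> R by rewrite pnatr_eq0 -lt0n fact_gt0.
by field; rewrite m0 mf0.
Qed.

Lemma continuous_exp_coeff (lam : R) m :
  continuous (fun s => exp_coeff (lam * s) m).
Proof.
case: m => [|m] t.
  under eq_fun do rewrite /exp_coeff /= expr0; exact: cvg_cst.
have [d _] := is_derive_exp_coeff lam t m.
exact/differentiable_continuous/derivable1_diffP.
Qed.

(** One Picard step: [exp_coeff (lam * t) m.+1] vanishes at 0 and has derivative
    [lam * exp_coeff (lam * t) m]. *)
Lemma picard_increment_le (f df : R -> R) (T lam M : R) m :
  0 <= T -> continuous f ->
  (forall t, 0 < t < T -> is_derive t 1 f (df t)) ->
  (forall t, 0 < t < T -> df t <= lam * M * exp_coeff (lam * t) m) ->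
  f T - f 0 <= M * exp_coeff (lam * T) m.+1.
Proof.
move=> T0 cf df_ dfl.
have -> : M * exp_coeff (lam * T) m.+1 =
    M * exp_coeff (lam * T) m.+1 - M * exp_coeff (lam * 0) m.+1.
  by rewrite /exp_coeff /= mulr0 expr0n /= mul0r mulr0 subr0.
apply: (@increment_le _ f (fun t => M * exp_coeff (lam * t) m.+1) df
  (fun t => M * (lam * exp_coeff (lam * t) m))) => //.
- by apply: continuous_mul; [exact: continuous_cst|exact: continuous_exp_coeff].
- by move=> t _; exact: (is_derive_scale M (is_derive_exp_coeff lam t m)).
- by move=> t /dfl dft; rewrite mulrCA mulrA.
Qed.

(** Decay in space, uniform on each bounded time interval, is what removes the flux at [n] in the
    limit; the rate may depend on [T]. *)
Definition decaying_solution (f : R -> nat -> R) : Prop :=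
  [/\ forall x, continuous (fun t => f t x),
      forall t x, 0 < t ->
        is_derive t 1 (fun s => f s x) (2^-1 * generator (f t) x) &
      forall T, exists2 r : nat -> R, r n @[n --> \oo] --> 0 &
        forall t x, 0 <= t <= T -> `|f t x| <= r x].

Lemma decaying_solutionB (f g : R -> nat -> R) :
  decaying_solution f -> decaying_solution g ->
  decaying_solution (fun t x => f t x - g t x).
Proof.
move=> [cf df rf] [cg dg rg]; split.
- by move=> x; exact: continuous_sub.
- move=> t x t0; rewrite generatorB mulrBr.
  exact: (is_derive_sub (df _ _ t0) (dg _ _ t0)).
- move=> T; have [r r0 fr] := rf T; have [s s0 gs] := rg T.
  exists (r + s); first by rewrite -[0]addr0; exact: cvgD.
  move=> t x tT; apply: le_trans (ler_normB _ _) _.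
  by apply: lerD; [exact: fr|exact: gs].
Qed.

Lemma flux_cvg0 (r s : nat -> R) :
  r n @[n --> \oo] --> 0 -> s n @[n --> \oo] --> 0 ->
  r n * s n.+1 + s n * r n.+1 @[n --> \oo] --> 0.
Proof.
move=> r0 s0; have r1 := cvg_comp _ _ (cvg_addnr 1) r0.
have s1 := cvg_comp _ _ (cvg_addnr 1) s0.
have -> : (fun n => r n * s n.+1 + s n * r n.+1) =
    (fun n => r n * s (n + 1)%N + s n * r (n + 1)%N).
  by apply/funext => n; rewrite addn1.
have := cvgD (cvgM r0 s1) (cvgM s0 r1).
by rewrite !mul0r addr0; apply.
Qed.

(* The derivative in [s] of the partial sums is, by Green's formula, a boundary
   flux at [n], which the decay of the solutions kills. *)
Lemma pairing_cvg (f g : R -> nat -> R) (t s : R) :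
  decaying_solution f -> decaying_solution g -> 0 <= s <= t ->
  (\sum_(z < n.+1) f (t - s) z * g s z) - (\sum_(z < n.+1) f t z * g 0 z)
    @[n --> \oo] --> 0.
Proof.
move=> [cf df rf] [cg dg rg] /andP[s0 st].
have [r r0 fr] := rf t; have [q q0 gq] := rg t.
pose flux n := r n * q n.+1 + q n * r n.+1.
have : flux n * s @[n --> \oo] --> 0.
  by rewrite -[X in _ --> X](mul0r s); apply: cvgMl; exact: flux_cvg0.
move=> fl0; apply: norm_cvg0.
apply: (@squeeze_cvgr _ _ _ _ (fun=> 0) (fun n => flux n * s)) => //;
  last exact: cvg_cst.
apply: nearW => n; rewrite normr_ge0 /=.
pose V u := \sum_(z < n.+1) f (t - u) z * g u z.
have VE u : V u = \sum_(z < n.+1) f (-1 * u + t) z * g u z.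
  by apply: eq_bigr => z _; rewrite mulN1r addrC.
have -> : \sum_(z < n.+1) f t z * g 0 z = V 0 by rewrite /V subr0.
rewrite -/(V s) -[X in _ * X]subr0.
apply: (@increment_norm_le _ V (fun u => \sum_(z < n.+1)
   (f (t - u) z * (2^-1 * generator (g u) z)
    + g u z * (-1 * (2^-1 * generator (f (t - u)) z))))) => //.
- rewrite (_ : V = fun u => \sum_(z < n.+1) f (-1 * u + t) z * g u z);
    last exact/funext.
  apply: (@continuous_bigsum _ _ (fun z u => f (-1 * u + t) z * g u z)) => z.
  by apply: continuous_mul => //; exact: (@continuous_comp_affine _ (f ^~ z)).
- move=> u /andP[u0 us].
  rewrite (_ : V = fun u => \sum_(z < n.+1) f (-1 * u + t) z * g u z);
    last exact/funext.
  apply: (@is_derive_bigsum _ _ (fun z u => f (-1 * u + t) z * g u z)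
   (fun z u => f (t - u) z * (2^-1 * generator (g u) z)
    + g u z * (-1 * (2^-1 * generator (f (t - u)) z)))) => z.
  rewrite (_ : t - u = -1 * u + t); last ring.
  have tu : 0 < -1 * u + t by rewrite mulN1r; lra.
  exact: (is_derive_mul (is_derive_comp_affine (df _ z tu)) (dg _ z u0)).
- move=> u /andP[u0 us].
  have -> : \sum_(z < n.+1)
   (f (t - u) z * (2^-1 * generator (g u) z)
    + g u z * (-1 * (2^-1 * generator (f (t - u)) z))) =
    2^-1 * (c n * (f (t - u) n * g u n.+1 - g u n * f (t - u) n.+1)).
    by rewrite -green_generator mulr_sumr; apply: eq_bigr => z _; ring.
  have fb z : `|f (t - u) z| <= r z by apply: fr; apply/andP; split; lra.
  have gb z : `|g u z| <= q z by apply: gq; apply/andP; split; lra.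
  have /andP[cn0 cn1] := c01 n.
  rewrite !normrM (ger0_norm cn0) ger0_norm; last by rewrite invr_ge0.
  have B : `|f (t - u) n * g u n.+1 - g u n * f (t - u) n.+1| <= flux n.
    by apply: le_trans (ler_normB _ _) _; rewrite !normrM lerD// ler_pM.
  have := le_trans (normr_ge0 _) B.
  have := normr_ge0 (f (t - u) n * g u n.+1 - g u n * f (t - u) n.+1).
  move: B; set X := `|_|; set Y := flux n; nra.
Qed.

(** By [energy_generator] the energy of the first sites can grow only through the flux at [n], which
    tends to 0. The energies enter as given limits; the semigroup law will supply them. *)
Lemma energy_nonincreasing (f : R -> nat -> R) (s t es et : R) :
  decaying_solution f -> 0 <= s <= t ->
  \sum_(z < n.+1) f s z ^+ 2 @[n --> \oo] --> es ->
  \sum_(z < n.+1) f t z ^+ 2 @[n --> \oo] --> et -> et <= es.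
Proof.
move=> [cf df rf] /andP[s0 st] cs ct.
have [r r0 fr] := rf t.
pose flux n := r n * r n.+1 + r n * r n.+1.
have fl0 : flux n * (t - s) @[n --> \oo] --> 0.
  by rewrite -[X in _ --> X](mul0r (t - s)); apply: cvgMl; exact: flux_cvg0.
apply: (ler_cvgn_err ct cs fl0) => n; rewrite -lerBlDl.
pose V u := \sum_(z < n.+1) f u z * f u z.
have VE u : \sum_(z < n.+1) f u z ^+ 2 = V u.
  by apply: eq_bigr => z _; rewrite expr2.
rewrite !VE.
apply: (@increment_le_cst _ V (fun u => \sum_(z < n.+1)
   (f u z * (2^-1 * generator (f u) z) +
    f u z * (2^-1 * generator (f u) z)))) => //.
- apply: (@continuous_bigsum _ _ (fun z u => f u z * f u z)) => z.
  exact: continuous_mul.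
- move=> u /andP[us ut].
  apply: (@is_derive_bigsum _ _ (fun z u => f u z * f u z)
    (fun z u => f u z * (2^-1 * generator (f u) z) +
                f u z * (2^-1 * generator (f u) z))) => z.
  have u0 : 0 < u by lra.
  exact: (is_derive_mul (df _ z u0) (df _ z u0)).
- move=> u /andP[us ut].
  have fb z : `|f u z| <= r z by apply: fr; apply/andP; split; lra.
  have -> : \sum_(z < n.+1)
   (f u z * (2^-1 * generator (f u) z) + f u z * (2^-1 * generator (f u) z)) =
   \sum_(z < n.+1) f u z * generator (f u) z by apply: eq_bigr => z _; field.
  apply: le_trans (energy_generator _ _) _.
  have /andP[cn0 cn1] := c01 n.
  have B : `|f u n * f u n.+1| <= r n * r n.+1 by rewrite normrM ler_pM.
  have B0 := le_trans (normr_ge0 _) B.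
  have : c n * (f u n * f u n.+1) <= r n * r n.+1.
    apply: le_trans (ler_norm _) _; rewrite normrM (ger0_norm cn0).
    by apply: le_trans B; rewrite ler_piMl.
  have := mulr_ge0 cn0 (sqr_ge0 (f u n)); rewrite /flux.
  nra.
Qed.

End birth_death.

(** * Birth-death kernels *)

Section birth_death_kernel.
Variables (R : realType) (c k : nat -> R).
Hypothesis c01 : forall x, 0 <= c x <= 1.
Hypothesis k01 : forall x, 0 <= k x <= 1.
Implicit Types s t u T : R.

(** The bound is local in time, which on the segment is what continuity yields; the global bound by
    1 is derived in [kernel_le1]. *)
Definition birth_death_kernel (K : R -> nat -> nat -> R) : Prop :=
  [/\ forall x y, K 0 x y = (x == y)%:R,
      forall x y, continuous (fun t => K t x y),
      forall t x y, 0 < t ->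
        is_derive t 1 (fun s => K s x y) (2^-1 * generator c k (K t ^~ y) x) &
      forall y T, exists M : R, forall t x, 0 <= t <= T -> `|K t x y| <= M].

Lemma sum_delta (f : nat -> R) (y n : nat) : (y <= n)%N ->
  \sum_(z < n.+1) f z * (val z == y)%:R = f y.
Proof.
rewrite -ltnS => yn; rewrite (bigD1 (Ordinal yn)) //= eqxx mulr1.
rewrite big1 ?addr0// => i; rewrite -val_eqE /= => /negPf ->.
by rewrite mulr0.
Qed.

Lemma cvg_sum_delta (f g : nat -> R) (y : nat) :
  (forall z, g z = (z == y)%:R) ->
  \sum_(z < n.+1) f z * g z @[n --> \oo] --> f y.
Proof.
move=> gE; apply: cvg_near_cst; near=> n.
under eq_bigr do rewrite gE; apply: sum_delta; near: n; exact: nbhs_infty_ge.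
Unshelve. all: by end_near. Qed.

Variable K : R -> nat -> nat -> R.
Hypothesis K_kernel : birth_death_kernel K.

(* The generator is bounded and has range one, so the Picard iteration gains a
   factor [3 t / m] for each unit of distance to the diagonal. *)
Lemma kernel_tail y T M : (forall t x, 0 <= t <= T -> `|K t x y| <= M) ->
  forall m x t, (y + m <= x)%N -> 0 <= t <= T ->
    `|K t x y| <= M * exp_coeff (3 * t) m.
Proof.
move=> KM; have [K0 cK dK _] := K_kernel.
elim=> [|m IHm] x t yx /andP[t0 tT].
  by rewrite /exp_coeff /= expr0 fact0 divr1 mulr1; apply: KM; rewrite t0.
have K0x : K 0 x y = 0 by rewrite K0; case: eqP => // ?; lia.
have bound s : 0 < s < t ->
    `|2^-1 * generator c k (K s ^~ y) x| <= 3 * M * exp_coeff (3 * s) m.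
  move=> /andP[s0 st]; rewrite normrM ger0_norm ?invr_ge0//.
  have sT : 0 <= s <= T by lra.
  have : `|generator c k (K s ^~ y) x| <= 6 * (M * exp_coeff (3 * s) m).
    by apply: generator_norm_le => //; apply: IHm => //; lia.
  by lra.
have up : K t x y <= M * exp_coeff (3 * t) m.+1.
  rewrite -[K t x y]subr0 -K0x.
  apply: (@picard_increment_le _ (fun s => K s x y)
    (fun s => 2^-1 * generator c k (K s ^~ y) x)) => //.
    by move=> s /andP[s0 _]; exact: dK.
  by move=> s /bound; apply/le_trans/ler_norm.
have dn : -1 * K t x y <= M * exp_coeff (3 * t) m.+1.
  rewrite (_ : -1 * K t x y = -1 * K t x y - -1 * K 0 x y); last first.
    by rewrite K0x; ring.
  apply: (@picard_increment_le _ (fun s => -1 * K s x y)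
    (fun s => -1 * (2^-1 * generator c k (K s ^~ y) x))) => //.
  - by apply: continuous_mul => //; exact: continuous_cst.
  - by move=> s /andP[s0 _]; exact: (is_derive_scale (-1) (dK s x y s0)).
  - by move=> s /bound; apply/le_trans; rewrite mulN1r -normrN ler_norm.
by rewrite ler_norml up andbT; lra.
Qed.

Lemma kernel_decaying y : decaying_solution c k (fun t x => K t x y).
Proof.
have [K0 cK dK bK] := K_kernel.
split=> // [t x t0|T]; first exact: dK.
have [M KM] := bK y T; have [T0|T0] := ltP T 0.
  exists (fun=> 0); first exact: cvg_cst.
  by move=> t x tT; exfalso; lra.
have M0 : 0 <= M by apply: le_trans (normr_ge0 _) (KM 0 0%N _); rewrite lexx.
(* Left of [y] the difference truncates to 0 and the bound is [M] itself. *)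
exists (fun x => M * exp_coeff (3 * T) (x - y)%N).
  rewrite -[X in _ --> X](mulr0 M); apply: cvgMr.
  apply: (cvg_comp (fun n => (n - y)%N) (exp_coeff (3 * T)));
    last exact: cvg_exp_coeff.
  exact: cvg_subnr.
move=> t x tT; have [yx|xy] := leqP y x; last first.
  rewrite (_ : (x - y)%N = 0%N); last by lia.
  by rewrite /exp_coeff /= expr0 fact0 divr1 mulr1; exact: KM.
have yx' : (y + (x - y) <= x)%N by lia.
apply: (le_trans (kernel_tail KM yx' tT)); rewrite ler_wpM2l// /exp_coeff /=.
rewrite ler_wpM2r ?invr_ge0//; move/andP: tT => [t0 tT].
by rewrite lerXn2r ?nnegrE ?mulr_ge0 ?ler_wpM2l.
Qed.

(* After multiplication by [exp (2 s)] the equation has nonnegative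
   coefficients. *)
Lemma kernel_ge0 t x y : 0 <= t -> 0 <= K t x y.
Proof.
move=> t0; have [K0 cK dK bK] := K_kernel.
have [M KM] := bK y t.
have M0 : 0 <= M by apply: le_trans (normr_ge0 _) (KM 0 0%N _); rewrite lexx.
pose v s z := expR (2 * s) * K s z y.
pose dv s z := expR (2 * s) * (2^-1 * generator c k (K s ^~ y) z) +
               K s z y * (2 * expR (2 * s)).
have cexp : continuous (fun s => expR (2 * s)).
  move=> s; apply: (@continuous_comp _ _ _ (fun s => 2 * s) (@expR R)).
    by apply: cvgM; [exact: cvg_cst|exact: cvg_id].
  exact: continuous_expR.
have cv z : continuous (fun s => -1 * v s z).
  by apply: continuous_mul; [exact: continuous_cst|exact: continuous_mul].
have dexp s : is_derive s 1 (fun s => expR (2 * s)) (2 * expR (2 * s)).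
  have H := is_derive_comp_affine (f := expR) (k := 2) (b := 0).
  have /H := is_derive_expR (2 * s + 0).
  rewrite addr0; congr (is_derive _ _ _ _); apply/funext => u.
  by rewrite addr0.
have dvP z s : 0 < s -> is_derive s 1 (fun s => -1 * v s z) (-1 * dv s z).
  move=> s0.
  exact: (is_derive_scale (-1) (is_derive_mul (dexp s) (dK s z y s0))).
pose M' := expR (2 * t) * M.
have M'0 : 0 <= M' by rewrite mulr_ge0// expR_ge0.
(* Each round sharpens the lower bound on [v] by one Picard step; as [m] grows the bound tends to
   0. *)
have key m : forall z s, 0 <= s <= t -> -1 * v s z <= M' * exp_coeff (2 * s) m.
  elim: m => [|m IHm] z s /andP[s0 st].
    rewrite /exp_coeff /= expr0 fact0 divr1 mulr1 mulN1r.
    apply: le_trans (ler_norm _) _; rewrite normrN normrM ger0_norm ?expR_ge0//.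
    by rewrite ler_pM ?expR_ge0 ?ler_expR ?ler_wpM2l ?KM ?s0.
  apply: (@le_trans _ _ (-1 * v s z - -1 * v 0 z)).
    rewrite lerBrDr gerDl mulN1r oppr_le0 /v K0.
    by rewrite mulr_ge0 ?expR_ge0.
  apply: (@picard_increment_le _ (fun s => -1 * v s z) (fun s => -1 * dv s z)
    _ _ _ _ s0 (cv z)); first by move=> u /andP[u0 _]; exact: dvP.
  move=> u /andP[u0 us].
  have ut : 0 <= u <= t by lra.
  have := IHm z u ut; have := IHm z.+1 u ut; have := IHm z.-1 u ut.
  have B0 : 0 <= M' * exp_coeff (2 * u) m.
    by rewrite mulr_ge0// exp_coeff_ge0// mulr_ge0// ltW.
  rewrite -mulrA; move: B0; set B := M' * _.
  have -> : -1 * dv u z = -1 * (2^-1 * generator c k (v u) z + 2 * v u z).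
    by rewrite /dv /v /generator; ring.
  rewrite /generator.
  move: (v u z) (v u z.+1) (v u z.-1) => a1 a2 a3 B0 h3 h2 h1.
  have /andP[p1 p2] := c01 z; have /andP[p3 p4] := c01 z.-1.
  have /andP[p5 p6] := k01 z.
  (* The derivative of [v] at [z] is half a combination of [a1], [a2], [a3] with nonnegative
     coefficients of sum [4 - k z], at most 4: hence the rate 2. *)
  have q1 : 0 <= c z * (a2 + B) by rewrite mulr_ge0//; lra.
  have q2 : 0 <= c z.-1 * (a3 + B) by rewrite mulr_ge0//; lra.
  have q3 : 0 <= (4 - c z - c z.-1 - k z) * (a1 + B) by rewrite mulr_ge0//; lra.
  have q4 : 0 <= k z * B by rewrite mulr_ge0.
  by lra.
have vt : 0 <= v t x.
  suff : -1 * v t x <= 0 by lra.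
  apply: (@ler_cvgn_err _ (fun=> -1 * v t x) (fun m => M' * exp_coeff (2 * t) m)
    (fun=> 0)); [exact: cvg_cst| |exact: cvg_cst|].
  - by rewrite -[X in _ --> X](mulr0 M'); apply: cvgMr; exact: cvg_exp_coeff.
  - by move=> m; rewrite addr0; apply: key; rewrite t0 /=.
by rewrite /v pmulr_rge0 ?expR_gt0 in vt.
Qed.

(** In the limit, the pairing of column [x] at time [t - s] with column [y] at time [s] does not
    depend on [s]; at [s = t] and at [s = 0] one factor is a delta. *)
Lemma kernel_sym t x y : 0 <= t -> K t x y = K t y x.
Proof.
move=> t0; have [K0 _ _ _] := K_kernel.
have tt : 0 <= t <= t by lra.
have := pairing_cvg c01 (kernel_decaying x) (kernel_decaying y) tt.
rewrite subrr.
have c1 : \sum_(z < n.+1) K 0 z x * K t z y @[n --> \oo] --> K t x y.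
  under eq_fun do under eq_bigr do rewrite mulrC.
  by apply: (@cvg_sum_delta (K t ^~ y) (K 0 ^~ x)) => z; rewrite K0.
have c2 : \sum_(z < n.+1) K t z x * K 0 z y @[n --> \oo] --> K t y x.
  by apply: (@cvg_sum_delta (K t ^~ x) (K 0 ^~ y)) => z; rewrite K0.
move=> c0; apply/eqP; rewrite -subr_eq0; apply/eqP; apply: cvgn_uniq c0.
exact: cvgB.
Qed.

(** The same pairing over the total time [2 * t], compared at the midpoint and at [s = 0]. *)
Lemma kernel_semigroup t x y : 0 <= t ->
  \sum_(z < n.+1) K t z x * K t z y @[n --> \oo] --> K (2 * t) x y.
Proof.
move=> t0; have [K0 _ _ _] := K_kernel.
have tt : 0 <= t <= 2 * t by lra.
have := pairing_cvg c01 (kernel_decaying x) (kernel_decaying y) tt.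
rewrite (_ : 2 * t - t = t); last by ring.
have c2 : \sum_(z < n.+1) K (2 * t) z x * K 0 z y @[n --> \oo] -->
    K (2 * t) x y.
  rewrite kernel_sym; last by lra.
  by apply: (@cvg_sum_delta (K (2 * t) ^~ x) (K 0 ^~ y)) => z; rewrite K0.
move=> c0; rewrite -[K _ _ _]add0r.
rewrite (_ : (fun n => _) = (fun n => (\sum_(z < n.+1) K t z x * K t z y -
    \sum_(z < n.+1) K (2 * t) z x * K 0 z y) +
    \sum_(z < n.+1) K (2 * t) z x * K 0 z y)).
  exact: cvgD.
by apply/funext => n; rewrite subrK.
Qed.

(** The square of an entry is at most the energy of its column, which starts at 1 and never
    increases. *)
Lemma kernel_le1 t x y : 0 <= t -> K t x y <= 1.
Proof.
move=> t0; have [K0 _ _ _] := K_kernel.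
have sq s : 0 <= s ->
    \sum_(z < n.+1) K s z y ^+ 2 @[n --> \oo] --> K (2 * s) y y.
  move=> s0; under eq_fun do under eq_bigr do rewrite expr2.
  exact: kernel_semigroup.
have tt : (0 : R) <= 0 <= t by rewrite lexx.
have := energy_nonincreasing c01 k01 (kernel_decaying y) tt (sq 0 (lexx _))
  (sq t t0).
rewrite mulr0 K0 eqxx => e1.
have : K t x y ^+ 2 <= K (2 * t) y y.
  apply: (cvgr_to_ge (sq t t0)); near=> n.
  have xn : (x < n.+1)%N by rewrite ltnS; near: n; exact: nbhs_infty_ge.
  rewrite (bigD1 (Ordinal xn)) //= lerDl sumr_ge0// => i _; exact: sqr_ge0.
move=> /le_trans /(_ e1); rewrite expr_le1//; exact: kernel_ge0.
Unshelve. all: by end_near. Qed.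

End birth_death_kernel.

(** * The Gram matrix of the gradients and its primitive *)

(** The first hypothesis says [|f| <= 2 sqrt d] without square roots; the second makes [d] of order
    [1 / T]. *)
Lemma cvg_pinfty0_of_tradeoff (R : realType) (f d : R -> R) (C : R) :
  (forall T e, 0 < T -> 0 < e -> `|f T| <= e + d T / e) ->
  (forall T, 0 < T -> T * d T <= C) -> f T @[T --> +oo] --> 0.
Proof.
move=> fd dC; apply/cvgr0Pnorm_le => e e0; near=> T.
have T0 : 0 < T by near: T; exact: nbhs_pinfty_gt.
have e20 : 0 < e / 2 by rewrite divr_gt0.
apply: (le_trans (fd T _ T0 e20)).
suff : d T / (e / 2) <= e / 2 by lra.
rewrite ler_pdivrMr// -(ler_pM2l T0); apply: (le_trans (dC _ T0)).
rewrite -ler_pdivrMr ?mulr_gt0//; near: T; exact: nbhs_pinfty_ge.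
Unshelve. all: by end_near. Qed.

Lemma is_derive_generator (R : realType) (c k : nat -> R) (f : R -> nat -> R)
    (df : nat -> R) (t : R) (x : nat) :
  (forall z, is_derive t 1 (fun s => f s z) (df z)) ->
  is_derive t 1 (fun s => generator c k (f s) x) (generator c k df x).
Proof.
move=> fdf; have d z z' := is_derive_sub (fdf z) (fdf z').
exact: (is_derive_sub (is_derive_sub (is_derive_scale (c x) (d x.+1 x))
  (is_derive_scale (c x.-1) (d x x.-1))) (is_derive_scale (k x) (fdf x))).
Qed.

Lemma continuous_generator (R : realType) (c k : nat -> R) (f : R -> nat -> R)
    (x : nat) :
  (forall z, continuous (fun s => f s z)) ->
  continuous (fun s => generator c k (f s) x).
Proof.
move=> cf; rewrite /generator.
apply: continuous_sub; first apply: continuous_sub.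
- by apply: continuous_mul; [exact: continuous_cst|exact: continuous_sub].
- by apply: continuous_mul; [exact: continuous_cst|exact: continuous_sub].
- by apply: continuous_mul; [exact: continuous_cst|].
Qed.

(** Cauchy-Schwarz as a weighted arithmetic-geometric inequality; the weight [e] stays free for
    [cvg_pinfty0_of_tradeoff]. *)
Lemma norm_pairing_le (R : realType) (a b : nat -> R) (A B S e : R) : 0 < e ->
  \sum_(y < n.+1) a y ^+ 2 @[n --> \oo] --> A ->
  \sum_(y < n.+1) b y ^+ 2 @[n --> \oo] --> B ->
  \sum_(y < n.+1) a y * b y @[n --> \oo] --> S -> `|S| <= e * A + B / e.
Proof.
move=> e0 aA bB abS.
have AB : \sum_(y < n.+1) (e * a y ^+ 2 + b y ^+ 2 / e) @[n --> \oo] -->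
    e * A + B / e.
  rewrite (_ : (fun n => _) = (fun n =>
    e * \sum_(y < n.+1) a y ^+ 2 + (\sum_(y < n.+1) b y ^+ 2) / e)).
    by apply: cvgD; [exact: cvgMr|exact: cvgMl].
  by apply/funext => n; rewrite big_split /= mulr_sumr mulr_suml.
apply: (@ler_cvgn_err _ _ _ (fun=> 0) _ _ (cvg_norm abS) AB).
  exact: cvg_cst.
move=> n; rewrite addr0; apply: le_trans (ler_norm_sum _ _ _) _.
apply: ler_sum => y _; rewrite normrM -(real_normK (num_real (a y))).
rewrite -(real_normK (num_real (b y))).
move: (`|a y|) (`|b y|) (normr_ge0 (a y)) (normr_ge0 (b y)) => p q p0 q0.
have -> : q ^+ 2 = e * (q / e) ^+ 2 * e by field; rewrite gt_eqF.
rewrite mulfK ?gt_eqF//.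
have -> : p * q = e * (p * (q / e)) by field; rewrite gt_eqF.
rewrite -mulrDr ler_pM2l//.
have : 0 <= (q / e) by rewrite divr_ge0// ltW.
by move: (q / e) => r r0; nra.
Qed.

Section killing_potential.
Variables (R : realType) (c k : nat -> R).
Hypothesis c01 : forall x, 0 <= c x <= 1.
Hypothesis k01 : forall x, 0 <= k x <= 1.
Variable K : R -> nat -> nat -> R.
Hypothesis K_kernel : birth_death_kernel c k K.
Implicit Types s t u T : R.

(** Sums of products at time [t] produce the kernel at time [2 * t]. In this clock the factor [2^-1]
    of the heat equation disappears. *)
Definition double_time t x y := K (2 * t) x y.

Local Notation H := double_time.

Lemma double_time0 x y : H 0 x y = (x == y)%:R.
Proof. by rewrite /double_time mulr0; have [->] := K_kernel. Qed.

Lemma continuous_double_time x y : continuous (fun t => H t x y).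
Proof.
have [_ cK _ _] := K_kernel.
have := @continuous_comp_affine _ _ 2 0 (cK x y).
by under eq_fun do rewrite addr0.
Qed.

Lemma is_derive_double_time t x y : 0 < t ->
  is_derive t 1 (fun s => H s x y) (generator c k (H t ^~ y) x).
Proof.
move=> t0; have [_ _ dK _] := K_kernel.
have t20 : 0 < 2 * t + 0 by lra.
rewrite (_ : (fun s => H s x y) = (fun s => K (2 * s + 0) x y)); last first.
  by apply/funext => s; rewrite addr0.
apply: (is_derive_eq (is_derive_comp_affine (dK _ x y t20))).
by rewrite addr0 mulrA divff// mul1r.
Qed.

Lemma double_time_ge0 t x y : 0 <= t -> 0 <= H t x y.
Proof.
by move=> t0; apply: (kernel_ge0 c01 k01 K_kernel); rewrite mulr_ge0.
Qed.

Lemma double_time_le1 t x y : 0 <= t -> H t x y <= 1.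
Proof.
by move=> t0; apply: (kernel_le1 c01 k01 K_kernel); rewrite mulr_ge0.
Qed.

Lemma double_time_sym t x y : 0 <= t -> H t x y = H t y x.
Proof.
by move=> t0; apply: (kernel_sym c01 k01 K_kernel); rewrite mulr_ge0.
Qed.

Definition gradient t x y := K t x.+1 y - K t x y.

Definition increment t xb z := H t z xb.+1 - H t z xb.

Definition gram t x xb := increment t xb x.+1 - increment t xb x.

Lemma increment_cvg t xb z : 0 <= t ->
  \sum_(y < n.+1) K t y z * gradient t xb y @[n --> \oo] --> increment t xb z.
Proof.
move=> t0; rewrite (_ : (fun n => _) = (fun n =>
  \sum_(y < n.+1) K t y z * K t y xb.+1 - \sum_(y < n.+1) K t y z * K t y xb)).
  by apply: cvgB; exact: (kernel_semigroup c01 k01 K_kernel).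
apply/funext => n; rewrite -sumrB; apply: eq_bigr => y _.
by rewrite /gradient !(kernel_sym c01 k01 K_kernel y)// mulrBr.
Qed.

Lemma gram_cvg t x xb : 0 <= t ->
  \sum_(y < n.+1) gradient t x y * gradient t xb y @[n --> \oo] --> gram t x xb.
Proof.
move=> t0; rewrite (_ : (fun n => _) = (fun n =>
  \sum_(y < n.+1) K t y x.+1 * gradient t xb y -
  \sum_(y < n.+1) K t y x * gradient t xb y)).
  by apply: cvgB; exact: increment_cvg.
apply/funext => n; rewrite -sumrB; apply: eq_bigr => y _.
by rewrite {1}/gradient !(kernel_sym c01 k01 K_kernel y)// mulrBl.
Qed.

Lemma double_time_diag_nonincreasing s t y : 0 <= s <= t -> H t y y <= H s y y.
Proof.
move=> st; have t0 : 0 <= t by lra.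
have s0 : 0 <= s by lra.
apply: (energy_nonincreasing c01 k01 (kernel_decaying c01 k01 K_kernel y) st).
- under eq_fun do under eq_bigr do rewrite expr2.
  exact: (kernel_semigroup c01 k01 K_kernel).
- under eq_fun do under eq_bigr do rewrite expr2.
  exact: (kernel_semigroup c01 k01 K_kernel).
Qed.

Lemma sqr_gradient_cvg t x : 0 <= t ->
  \sum_(y < n.+1) gradient t x y ^+ 2 @[n --> \oo] --> gram t x x.
Proof.
by move=> t0; under eq_fun do under eq_bigr do rewrite expr2; exact: gram_cvg.
Qed.

(** By symmetry [gram t x x] is the energy of the difference of two columns, itself a decaying
    solution. *)
Lemma gram_nonincreasing s t x : 0 <= s <= t -> gram t x x <= gram s x x.
Proof.
move=> st; have t0 : 0 <= t by lra.
have s0 : 0 <= s by lra.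
have dec := kernel_decaying c01 k01 K_kernel.
apply: (energy_nonincreasing c01 k01
  (decaying_solutionB (dec x.+1) (dec x)) st).
- rewrite (_ : (fun n => _) = (fun n => \sum_(y < n.+1) gradient s x y ^+ 2));
    first exact: sqr_gradient_cvg.
  by apply/funext => n; apply: eq_bigr => y _;
    rewrite /gradient !(kernel_sym c01 k01 K_kernel y).
- rewrite (_ : (fun n => _) = (fun n => \sum_(y < n.+1) gradient t x y ^+ 2));
    first exact: sqr_gradient_cvg.
  by apply/funext => n; apply: eq_bigr => y _;
    rewrite /gradient !(kernel_sym c01 k01 K_kernel y).
Qed.

(** [w t y] is the mass started at [y] and killed at 0 by time [2 * t]: the killing rate [k 0 / 2]
    becomes [k 0] in the doubled clock. It is kept abstract here, known only through its derivative
    and initial value. *)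
Variable w : R -> nat -> R.
Hypothesis cw : forall y, continuous (fun t => w t y).
Hypothesis w0 : forall y, w 0 y = 0.
Hypothesis dw : forall t y, 0 < t ->
  is_derive t 1 (fun s => w s y) (k 0%N * K (2 * t) y 0%N).

Lemma killing_nondecreasing s t y : 0 <= s <= t -> w s y <= w t y.
Proof.
move=> /andP[s0 st]; rewrite -subr_ge0 -(subrr 0).
apply: (@increment_le _ (fun=> 0) (w ^~ y) (fun=> 0)
  (fun u => k 0%N * K (2 * u) y 0%N)) => //.
- exact: continuous_cst.
- by move=> u us; apply: dw; lra.
- move=> u us; have /andP[k0 _] := k01 0%N.
  by rewrite mulr_ge0// double_time_ge0//; lra.
Qed.

Lemma killing_ge0 t y : 0 <= t -> 0 <= w t y.
Proof. by move=> t0; rewrite -(w0 y) killing_nondecreasing// lexx. Qed.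

(* The killed mass plus the surviving mass is at most one. *)
Lemma killing_le1 t y : 0 <= t -> w t y <= 1.
Proof.
move=> t0.
have [_ _ tail] := kernel_decaying c01 k01 K_kernel y.
have [r r0 Kr] := tail (2 * t).
have rt0 : r n.+1 * t @[n --> \oo] --> 0.
  rewrite -[X in _ --> X](mul0r t); apply: cvgMl.
  have := cvg_comp _ _ (cvg_addnr 1) r0.
  rewrite (_ : r \o _ = fun n => r n.+1)//.
  by apply/funext => n /=; rewrite addn1.
have d1 : \sum_(z < n.+1) 1 * H 0 z y @[n --> \oo] --> (1 : R).
  apply: (@cvg_sum_delta _ (fun=> 1) (H 0 ^~ y) y) => z.
  by rewrite double_time0.
apply: (ler_cvgn_err (@cvg_cst _ _ _ _ _) d1 rt0) => n.
pose V s := w s y + \sum_(z < n.+1) H s z y.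
have V0 : \sum_(z < n.+1) 1 * H 0 z y = V 0.
  by rewrite /V w0 add0r; apply: eq_bigr => z _; rewrite mul1r.
apply: (@le_trans _ _ (V t)).
  by rewrite lerDl sumr_ge0// => z _; exact: double_time_ge0.
rewrite V0 -lerBlDl -[X in _ * X]subr0.
apply: (@increment_le_cst _ V (fun s => k 0%N * K (2 * s) y 0%N +
  \sum_(z < n.+1) generator c k (H s ^~ y) z)) => //.
- apply: continuous_add => //.
  apply: (@continuous_bigsum _ _ (fun z s => H s z y)) => z.
  exact: continuous_double_time.
- move=> s /andP[s0 _]; apply: (is_derive_add (dw y s0)).
  apply: (@is_derive_bigsum _ _ (fun z s => H s z y)
    (fun z s => generator c k (H s ^~ y) z)) => z; exact: is_derive_double_time.
- move=> s /andP[s0 st]; rewrite sum_generator.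
  have s0' := ltW s0.
  (* Symmetry identifies the gain of [w], read at [(y, 0)], with the loss at the left end, read at
     [(0, y)]; the two cancel. *)
  rewrite big_ord_recl /= -/(H s y 0%N) (double_time_sym y 0%N s0').
  have : 0 <= \sum_(i < n) k (lift ord0 i) * H s (lift ord0 i) y.
    apply: sumr_ge0 => i _; apply: mulr_ge0; last exact: double_time_ge0.
    by have /andP[] := k01 (lift ord0 i).
  have /andP[cn0 cn1] := c01 n.
  have Hn := double_time_ge0 n y s0'; have Hn1 := double_time_ge0 n.+1 y s0'.
  have : H s n.+1 y <= r n.+1.
    apply: le_trans (ler_norm _) _; apply: Kr; lra.
  have := mulr_ge0 cn0 Hn.
  have : c n * H s n.+1 y <= H s n.+1 y by rewrite ler_piMl.
  lra.
Qed.

(** The heat equation integrated in time: [w] is the time integral of [k 0 * H s y 0], so its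
    generator is the increment of [k 0 * H] from time 0 to [t]. *)
Lemma generator_killing t y : 0 <= t ->
  generator c k (w t) y = k 0%N * (H t y 0%N - (y == 0%N)%:R).
Proof.
move=> t0; pose V s := generator c k (w s) y - k 0%N * H s y 0%N.
suff : V t = V 0.
  rewrite /V double_time0 {2}/generator !w0 !subrr !mulr0 !subr0 sub0r mulrBr.
  by move=> /eqP; rewrite subr_eq => /eqP ->; rewrite addrC.
apply: (@increment_eq0 _ V (fun s =>
  generator c k (fun z => k 0%N * K (2 * s) z 0%N) y -
  k 0%N * generator c k (H s ^~ 0%N) y)) => //.
- apply: continuous_sub; first exact: continuous_generator.
  apply: continuous_mul; first exact: continuous_cst.
  exact: continuous_double_time.
- move=> s /andP[s0 _].
  exact: (is_derive_sub (is_derive_generator c k y (fun z => dw z s0))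
    (is_derive_scale (k 0%N) (is_derive_double_time y 0%N s0))).
- by move=> s _; rewrite /generator /double_time; ring.
Qed.

(** On the diagonal at 0 the rate is nonincreasing with integral [w] at most 1, hence at most
    [1 / t]; Cauchy-Schwarz reaches the other [y]. The factor [k 0] matters: on a segment without
    killing [H] has a positive limit. *)
Lemma killing_rate_cvg0 y : k 0%N * H t y 0%N @[t --> +oo] --> 0.
Proof.
have /andP[k0 k1] := k01 0%N.
apply: (@cvg_pinfty0_of_tradeoff _ _ (fun t => k 0%N * H t 0%N 0%N) 1).
- move=> t e t0 e0; have t0' := ltW t0.
  rewrite normrM ger0_norm//.
  have sg x x' := @kernel_semigroup _ _ _ c01 k01 _ K_kernel t x x' t0'.
  have sq x : \sum_(z < n.+1) K t z x ^+ 2 @[n --> \oo] --> H t x x.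
    by under eq_fun do under eq_bigr do rewrite expr2; exact: sg.
  have := @norm_pairing_le _ (K t ^~ y) (K t ^~ 0%N) _ _ _ e e0 (sq y) (sq 0%N)
    (sg y 0%N) => /(ler_wpM2l k0) /le_trans; apply.
  rewrite (_ : k 0%N * (_ + _) =
    k 0%N * H t y y * e + k 0%N * H t 0%N 0%N / e); last by ring.
  rewrite lerD2r; apply: ler_piMl; first exact: ltW.
  by apply: mulr_ile1 => //; [exact: double_time_ge0|exact: double_time_le1].
- move=> t t0; apply: le_trans (killing_le1 0%N (ltW t0)).
  rewrite -[w t _]subr0 -(w0 0%N).
  rewrite (_ : t * _ =
    k 0%N * H t 0%N 0%N * t - k 0%N * H t 0%N 0%N * 0); last by ring.
  apply: (@increment_le _ (fun s => k 0%N * H t 0%N 0%N * s) (w ^~ 0%N)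
     (fun=> k 0%N * H t 0%N 0%N) (fun u => k 0%N * K (2 * u) 0%N 0%N)) => //.
  + exact: ltW.
  + by apply: continuous_mul; [exact: continuous_cst|move=> ?; exact: cvg_id].
  + by move=> s _; exact: is_derive_linear.
  + by move=> s /andP[s0 _]; exact: dw.
  + move=> s /andP[s0 st]; rewrite ler_wpM2l// double_time_diag_nonincreasing//.
    by rewrite !ltW.
Qed.

(** Under this condition the generator summed over the sites up to [x] is the difference across edge
    [x] minus the killing at 0. The killing at the right end of the segment thus stays out of the
    primitive. *)
Definition free_edge (x : nat) : Prop :=
  c x = 1 /\ forall z, (0 < z <= x)%N -> k z = 0.

Definition gram_primitive x xb t :=
  w t xb.+1 - w t xb + \sum_(z < x.+1) increment t xb z.

Lemma continuous_gram_primitive x xb : continuous (gram_primitive x xb).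
Proof.
apply: continuous_add; first exact: continuous_sub.
apply: (@continuous_bigsum _ _ (fun z t => increment t xb z)) => z.
by apply: continuous_sub; exact: continuous_double_time.
Qed.

Lemma is_derive_gram_primitive x xb t : free_edge x -> 0 < t ->
  is_derive t 1 (gram_primitive x xb) (gram t x xb).
Proof.
move=> [cx kx] t0.
have dinc z : is_derive t 1 (fun s => increment s xb z)
    (generator c k (increment t xb) z).
  rewrite generatorB.
  exact: (is_derive_sub (is_derive_double_time z xb.+1 t0)
    (is_derive_double_time z xb t0)).
apply: (is_derive_eq (is_derive_add (is_derive_sub (dw xb.+1 t0) (dw xb t0))
  (@is_derive_bigsum _ x.+1 (fun z s => increment s xb z)
     (fun z s => generator c k (increment s xb) z) t dinc))).
rewrite sum_generator cx mul1r big_ord_recl big1 => [|i _]; last first.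
  by rewrite kx ?mul0r//= /bump /= add1n ltnS.
rewrite -!/(H t _ 0%N) !(double_time_sym _ 0%N (ltW t0)) /gram /increment /=.
ring.
Qed.

Lemma increment_norm_le1 t xb z : 0 <= t -> `|increment t xb z| <= 1.
Proof.
move=> t0; rewrite ler_norml /increment.
have := double_time_ge0 z xb t0; have := double_time_ge0 z xb.+1 t0.
by have := double_time_le1 z xb t0; have := double_time_le1 z xb.+1 t0; lra.
Qed.

Lemma gram_primitive_norm_le x xb t : 0 <= t ->
  `|gram_primitive x xb t| <= 1 + x.+1%:R.
Proof.
move=> t0; apply: le_trans (ler_normD _ _) _; apply: lerD.
  rewrite ler_norml.
  have := killing_ge0 xb t0; have := killing_ge0 xb.+1 t0.
  by have := killing_le1 xb t0; have := killing_le1 xb.+1 t0; lra.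
apply: le_trans (ler_norm_sum _ _ _) _.
rewrite -[X in _ <= X%:R]card_ord -sum1_card natr_sum.
by apply: ler_sum => z _; exact: increment_norm_le1.
Qed.

(** The increment pairs column [z], of energy at most 1, with the gradient, of energy
    [gram t xb xb]. The latter is nonincreasing with a bounded primitive, hence O(1/t), even where
    the kernel itself has a nonzero limit. *)
Lemma increment_cvg0 xb z : free_edge xb -> increment t xb z @[t --> +oo] --> 0.
Proof.
move=> fxb.
apply: (@cvg_pinfty0_of_tradeoff _ _ (fun t => gram t xb xb)
  (2 * (1 + xb.+1%:R))).
- move=> t e t0 e0; have t0' := ltW t0.
  have sq : \sum_(y < n.+1) K t y z ^+ 2 @[n --> \oo] --> H t z z.
    under eq_fun do under eq_bigr do rewrite expr2.
    exact: (kernel_semigroup c01 k01 K_kernel).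
  apply: le_trans (@norm_pairing_le _ (K t ^~ z) (gradient t xb) _ _ _ e e0 sq
    (@sqr_gradient_cvg t xb t0') (@increment_cvg t xb z t0')) _.
  by rewrite lerD2r ler_piMr ?double_time_le1// ltW.
- move=> t t0; apply: (@le_trans _ _
    (gram_primitive xb xb t - gram_primitive xb xb 0)); last first.
    apply: le_trans (ler_norm _) _; apply: le_trans (ler_normB _ _) _.
    have := gram_primitive_norm_le xb xb (lexx 0).
    by have := gram_primitive_norm_le xb xb (ltW t0); lra.
  rewrite (_ : t * _ = gram t xb xb * t - gram t xb xb * 0); last by ring.
  apply: (@increment_le _ (fun s => gram t xb xb * s) (gram_primitive xb xb)
     (fun=> gram t xb xb) (fun s => gram s xb xb)) => //.
  + exact: ltW.
  + by apply: continuous_mul; [exact: continuous_cst|move=> ?; exact: cvg_id].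
  + exact: continuous_gram_primitive.
  + by move=> s _; exact: is_derive_linear.
  + by move=> s /andP[s0 _]; exact: is_derive_gram_primitive.
  + by move=> s /andP[s0 st]; rewrite gram_nonincreasing// !ltW.
Qed.

(** [W y] is the probability of ever being killed at 0 when starting from [y]. Its equation is
    [generator_killing] with [t] sent to infinity. *)
Lemma gram_potential_exists : exists W : nat -> R,
  [/\ forall y, 0 <= W y <= 1,
      forall y, generator c k W y = - (k 0%N * (y == 0%N)%:R) &
      forall x xb, free_edge x -> free_edge xb -> exists Q : R -> R,
        [/\ continuous Q, Q 0 = - (x == xb)%:R,
            forall t, 0 < t -> is_derive t 1 Q (gram t x xb) &
            Q t @[t --> +oo] --> W xb.+1 - W xb]].
Proof.
(* Freezing [w] at negative times makes it monotone on all of [R], as the convergence theorem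
   requires. *)
pose m t y := w (Num.max t 0) y.
have m_nd y : nondecreasing_fun (m ^~ y).
  move=> s t st; apply: killing_nondecreasing; rewrite le_max lexx orbT /=.
  by rewrite ge_max !le_max st lexx !orbT.
have m01 t y : 0 <= m t y <= 1.
  by rewrite killing_ge0 ?killing_le1// le_max lexx orbT.
have m_ub y : has_ubound (range (m ^~ y)).
  by exists 1 => _ [t _ <-]; have /andP[] := m01 t y.
pose W y := sup (range (m ^~ y)).
have mW y : m t y @[t --> +oo] --> W y by exact: nondecreasing_cvgr.
have wW y : w t y @[t --> +oo] --> W y.
  apply: cvg_trans (mW y); apply: near_eq_cvg; near=> t.
  by rewrite /m max_l//; near: t; exact: nbhs_pinfty_ge.
exists W; split.
- move=> y; apply/andP; split.
    by apply: (cvgr_to_ge (mW y)); apply: nearW => t; have /andP[] := m01 t y.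
  by apply: (cvgr_to_le (mW y)); apply: nearW => t; have /andP[] := m01 t y.
- move=> y.
  have c1 : generator c k (w t) y @[t --> +oo] --> generator c k W y.
    rewrite /generator; apply: cvgB; last by apply: cvgMr.
    by apply: cvgB; apply: cvgMr; exact: cvgB.
  have c2 : k 0%N * H t y 0%N - k 0%N * (y == 0%N)%:R @[t --> +oo] -->
      0 - k 0%N * (y == 0%N)%:R.
    by apply: cvgB; [exact: killing_rate_cvg0|exact: cvg_cst].
  rewrite -[RHS]sub0r.
  have c3 : generator c k (w t) y @[t --> +oo] --> 0 - k 0%N * (y == 0%N)%:R.
    apply: cvg_trans c2; apply: near_eq_cvg; near=> t.
    rewrite generator_killing ?mulrBr//; near: t; exact: nbhs_pinfty_ge.
  by rewrite -(cvg_lim (@Rhausdorff R) c1) -(cvg_lim (@Rhausdorff R) c3).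
- move=> x xb fx fxb; exists (gram_primitive x xb); split.
  + exact: continuous_gram_primitive.
  + rewrite /gram_primitive !w0 subrr add0r.
    rewrite (eq_bigr (fun z : 'I_x.+1 =>
       (val z == xb.+1)%:R - (val z == xb)%:R)) => [|z _]; last first.
      by rewrite /increment !double_time0.
    (* The deltas at [xb] and [xb.+1] are both out of range for [x < xb] and cancel for [x > xb];
       only [x = xb] leaves -1. *)
    elim: (x) => [|x' IHx]; first by rewrite big_ord1 /= sub0r.
    rewrite big_ord_recr /= IHx eqSS; ring.
  + by move=> t; exact: is_derive_gram_primitive.
  + rewrite -[X in _ --> X]addr0; apply: cvgD; first exact: cvgB.
    have := @cvg_bigsum R R (pinfty_nbhs R) _ x.+1
      (fun z t => increment t xb z) (fun=> 0) (fun z => increment_cvg0 z fxb).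
    by rewrite big1 //; apply; typeclasses eauto.
Unshelve. all: by end_near. Qed.

End killing_potential.

(** * Term-by-term integration *)

Section integral_series.
Variable R : realType.
Local Notation mu := (@lebesgue_measure R).
Local Notation D := (`[0%R, +oo[%classic : set R).
Implicit Types t : R.

(** Monotone convergence exchanges sum and integral, and the primitive evaluates the integral of
    [q]. Its finiteness also bounds the integral of each term, which gives integrability. *)
Lemma integral_series_ge0 (h : nat -> R -> R) (q Q : R -> R) (l : R) :
  (forall n, continuous (h n)) -> (forall n t, 0 <= h n t) ->
  continuous q -> continuous Q ->
  (forall t, 0 < t -> is_derive t 1 Q (q t)) -> Q t @[t --> +oo] --> l ->
  (forall t, 0 <= t -> \sum_(y < n.+1) h y t @[n --> \oo] --> q t) ->
  (forall n, mu.-integrable D (EFin \o h n)) /\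
  \sum_(0 <= y < n) (\int[mu]_(t in D) h y t)%R @[n --> \oo] --> l - Q 0.
Proof.
move=> ch h0 cq cQ dQ Ql hq.
have q0 t : 0 <= t -> 0 <= q t.
  move=> /hq hqt; apply: (cvgr_to_ge hqt); apply: nearW => n.
  exact: sumr_ge0.
have intq : (\int[mu]_(t in D) (q t)%:E = (l - Q 0)%:E)%E.
  rewrite EFinB; apply: ge0_continuous_FTC2y => //.
  - exact: continuous_subspaceT.
  - by move=> t /dQ [].
  - by apply: cvg_at_right_filter; exact: cQ.
  - move=> t; rewrite in_itv /= andbT => t0; rewrite derive1E.
    by have [_ ->] := dQ _ t0.
have mh n : measurable_fun D (h n).
  by apply: measurable_funTS; exact: continuous_measurable_fun.
have hq' t : D t -> (\sum_(n <oo) (h n t)%:E = (q t)%:E)%E.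
  rewrite /= in_itv /= andbT => t0; apply/cvg_lim => //.
  under eq_fun do rewrite sumEFin.
  apply: cvg_EFin; first by apply: nearW => n.
  rewrite -(cvg_shiftS (fun n => \sum_(0 <= i < n) h i t)) /=.
  by under eq_fun do rewrite big_mkord; exact: hq.
pose I n := (\int[mu]_(t in D) (h n t)%:E)%E.
have I0 n : (0 <= I n)%E by apply: integral_ge0 => t _; rewrite lee_fin.
have sumI : (\sum_(n <oo) I n = (l - Q 0)%:E)%E.
  rewrite -intq -integral_nneseries//; last 2 first.
    by move=> n; apply/measurable_EFinP; exact: mh.
    by move=> n t _; rewrite lee_fin.
  by apply: eq_integral => t; rewrite inE => /hq'.
have Ioo n : (I n < +oo)%E.
  apply: (@le_lt_trans _ _ (\sum_(n <oo) I n)%E); last by rewrite sumI ltry.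
  apply: le_trans (@nneseries_lim_ge R I xpredT 0%N n.+1 _) => //.
  rewrite big_mkord big_ord_recr /= leeDr//; exact: sume_ge0.
have inth n : mu.-integrable D (EFin \o h n).
  apply/integrableP; split; first by apply/measurable_EFinP; exact: mh.
  under eq_integral => t _ do rewrite /= ger0_norm//.
  exact: Ioo.
split => //.
have Ifin n : I n \is a fin_num by rewrite ge0_fin_numE.
have IE n : (\sum_(0 <= y < n) (\int[mu]_(t in D) h y t)%R)%:E =
    (\sum_(0 <= y < n) I y)%E.
  rewrite -sumEFin; apply: eq_bigr => y _.
  by rewrite /Rintegral fineK//; exact: Ifin.
have : (\sum_(0 <= y < n) I y)%E @[n --> \oo] --> (l - Q 0)%:E.
  by rewrite -sumI; exact: is_cvg_nneseries.
by under eq_fun do rewrite -IE; move/fine_cvg.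
Qed.

(* Polarization reduces products to squares, whose series converge
   monotonically. *)
Lemma integral_series_mul (f g : nat -> R -> R)
    (qff qfg qgg Qff Qfg Qgg : R -> R) (lff lfg lgg : R) :
  (forall n, continuous (f n)) -> (forall n, continuous (g n)) ->
  continuous qff -> continuous qfg -> continuous qgg ->
  continuous Qff -> continuous Qfg -> continuous Qgg ->
  (forall t, 0 < t -> is_derive t 1 Qff (qff t)) ->
  (forall t, 0 < t -> is_derive t 1 Qfg (qfg t)) ->
  (forall t, 0 < t -> is_derive t 1 Qgg (qgg t)) ->
  Qff t @[t --> +oo] --> lff -> Qfg t @[t --> +oo] --> lfg ->
  Qgg t @[t --> +oo] --> lgg ->
  (forall t, 0 <= t -> \sum_(y < n.+1) f y t * f y t @[n --> \oo] --> qff t) ->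
  (forall t, 0 <= t -> \sum_(y < n.+1) f y t * g y t @[n --> \oo] --> qfg t) ->
  (forall t, 0 <= t -> \sum_(y < n.+1) g y t * g y t @[n --> \oo] --> qgg t) ->
  (forall n, mu.-integrable D (EFin \o (fun t => f n t * g n t))) /\
  \sum_(0 <= y < n) (\int[mu]_(t in D) (f y t * g y t))%R @[n --> \oo] -->
    lfg - Qfg 0.
Proof.
move=> cf cg cqff cqfg cqgg cQff cQfg cQgg dQff dQfg dQgg lQff lQfg lQgg.
move=> sff sfg sgg.
have sq (a : R) : (forall n, mu.-integrable D
      (EFin \o (fun t => (f n t + a * g n t) * (f n t + a * g n t)))) /\
    \sum_(0 <= y < n)
      (\int[mu]_(t in D) ((f y t + a * g y t) * (f y t + a * g y t)))%R
      @[n --> \oo] --> (lff + (2 * a) * lfg + a ^+ 2 * lgg) -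
                       (Qff 0 + (2 * a) * Qfg 0 + a ^+ 2 * Qgg 0).
  have cfg n : continuous (fun t => f n t + a * g n t).
    apply: continuous_add => //; apply: continuous_mul => //.
    exact: continuous_cst.
  apply: (@integral_series_ge0
    (fun n t => (f n t + a * g n t) * (f n t + a * g n t))
    (fun t => qff t + (2 * a) * qfg t + a ^+ 2 * qgg t)
    (fun t => Qff t + (2 * a) * Qfg t + a ^+ 2 * Qgg t)).
  - by move=> n; exact: continuous_mul.
  - by move=> n t; rewrite -expr2 sqr_ge0.
  - by apply: continuous_add; [apply: continuous_add => //|];
      apply: continuous_mul => //; exact: continuous_cst.
  - by apply: continuous_add; [apply: continuous_add => //|];
      apply: continuous_mul => //; exact: continuous_cst.
  - move=> t t0.
    exact: (is_derive_add (is_derive_add (dQff _ t0)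
      (is_derive_scale (2 * a) (dQfg _ t0)))
      (is_derive_scale (a ^+ 2) (dQgg _ t0))).
  - by apply: cvgD; [apply: cvgD => //|]; exact: cvgMr.
  - move=> t t0; rewrite (_ : (fun n => _) = (fun n =>
      \sum_(y < n.+1) f y t * f y t + (2 * a) * \sum_(y < n.+1) f y t * g y t +
      a ^+ 2 * \sum_(y < n.+1) g y t * g y t)).
      by apply: cvgD; [apply: cvgD; [exact: sff|]|]; apply: cvgMr;
        [exact: sfg|exact: sgg].
    apply/funext => n; rewrite !mulr_sumr -!big_split /=.
    by apply: eq_bigr => y _; ring.
have [ip sp] := sq 1; have [im sm] := sq (-1).
have fgE n : (fun t => f n t * g n t) = (fun t => 4^-1 *
    ((f n t + 1 * g n t) * (f n t + 1 * g n t) -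
     (f n t + -1 * g n t) * (f n t + -1 * g n t))).
  by apply/funext => t; field.
have mD : measurable (D : set (measurableTypeR R)) by [].
have ipm n : mu.-integrable D (EFin \o (fun t =>
    (f n t + 1 * g n t) * (f n t + 1 * g n t) -
    (f n t + -1 * g n t) * (f n t + -1 * g n t))).
  by apply: (eq_integrable mD _ _ _ (integrableB mD (ip n) (im n))) => t _ /=.
split=> [n|].
  rewrite fgE.
  by apply: (eq_integrable mD _ _ _ (integrableZl mD (4^-1) (ipm n))).
have E n : \sum_(0 <= y < n) (\int[mu]_(t in D) (f y t * g y t))%R =
   4^-1 * (\sum_(0 <= y < n)
      (\int[mu]_(t in D) ((f y t + 1 * g y t) * (f y t + 1 * g y t)))%R -
    \sum_(0 <= y < n)
      (\int[mu]_(t in D) ((f y t + -1 * g y t) * (f y t + -1 * g y t)))%R).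
  rewrite -sumrB mulr_sumr; apply: eq_bigr => y _.
  by rewrite -RintegralB// -RintegralZl// fgE.
under eq_fun do rewrite E.
rewrite (_ : lfg - Qfg 0 = 4^-1 *
  ((lff + (2 * 1) * lfg + 1 ^+ 2 * lgg -
     (Qff 0 + (2 * 1) * Qfg 0 + 1 ^+ 2 * Qgg 0)) -
   (lff + (2 * -1) * lfg + (-1) ^+ 2 * lgg -
     (Qff 0 + (2 * -1) * Qfg 0 + (-1) ^+ 2 * Qgg 0)))); last by field.
by apply: cvgMr; exact: cvgB.
Qed.

End integral_series.

(** * The gradient series of a birth-death kernel *)

Theorem kernel_gradient_series (R : realType) (c k : nat -> R)
    (K : R -> nat -> nat -> R) :
  (forall x, 0 <= c x <= 1) -> (forall x, 0 <= k x <= 1) ->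
  birth_death_kernel c k K ->
  exists W : nat -> R,
  [/\ forall y, 0 <= W y <= 1,
      forall y, generator c k W y = - (k 0%N * (y == 0%N)%:R) &
      forall x xb, free_edge c k x -> free_edge c k xb ->
        (forall y, (@lebesgue_measure R).-integrable `[0, +oo[
          (EFin \o (fun t => gradient K t x y * gradient K t xb y))) /\
        \sum_(0 <= y < n) (\int[@lebesgue_measure R]_(t in `[0%R, +oo[)
          (gradient K t x y * gradient K t xb y))%R @[n --> \oo] -->
          (x == xb)%:R + (W xb.+1 - W xb)].
Proof.
move=> c01 k01 KK; have [_ cK _ _] := KK.
have ex_w y : exists F : R -> R, [/\ continuous F, F 0 = 0 &
    forall t : R, 0 < t -> is_derive t 1 F (k 0%N * K (2 * t) y 0%N)].
  have [|F cF [F0 dF]] := @continuous_is_primitive R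
      (fun t => k 0%N * K (2 * t) y 0%N).
    by apply: continuous_mul; [exact: continuous_cst|
      exact: (continuous_double_time KK)].
  by exists F; split.
pose w t y := sval (cid (ex_w y)) t.
have [W [W01 WE WQ]] : _ := @gram_potential_exists R c k c01 k01 K KK w
  (fun y => let: And3 h _ _ := svalP (cid (ex_w y)) in h)
  (fun y => let: And3 _ h _ := svalP (cid (ex_w y)) in h)
  (fun t y => let: And3 _ _ h := svalP (cid (ex_w y)) in h t).
exists W; split => // x xb fx fxb.
have cg z y : continuous (fun t => gradient K t z y).
  by apply: continuous_sub; exact: cK.
have cgram z z' : continuous (fun t => gram K t z z').
  by do 2![apply: continuous_sub]; exact: (continuous_double_time KK).
have [Q1 [c1 _ d1 l1]] := WQ x x fx fx.
have [Q2 [c2 Q20 d2 l2]] := WQ x xb fx fxb.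
have [Q3 [c3 _ d3 l3]] := WQ xb xb fxb fxb.
rewrite [_ + (_ - _)]addrC -[X in _ --> _ + X]opprK -Q20.
apply: (@integral_series_mul R (fun y t => gradient K t x y)
  (fun y t => gradient K t xb y) (fun t => gram K t x x)
  (fun t => gram K t x xb) (fun t => gram K t xb xb) Q1 Q2 Q3 _ _ _) => //.
- exact: l1.
- exact: l3.
- by move=> t; exact: (gram_cvg c01 k01 KK).
- by move=> t; exact: (gram_cvg c01 k01 KK).
- by move=> t; exact: (gram_cvg c01 k01 KK).
Qed.

(** * The half line *)

Section heat_equation.
Variables (R : realType) (D : set int) (p : R -> int -> int -> R).
Hypothesis p_heat : heat_equation_on D p.

Lemma continuous_heat_even x y : D x -> D y ->
  continuous (fun t : R => p `|t| x y).
Proof.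
move=> Dx Dy; have [_ p0 dp] := p_heat Dx Dy.
apply: (@continuous_even_ext _ (fun t => p t x y)) => // t /dp[dpt _].
exact/differentiable_continuous/derivable1_diffP.
Qed.

Lemma is_derive_heat_even x y (t : R) : D x -> D y -> 0 < t ->
  is_derive t 1 (fun s : R => p `|s| x y)
    (2^-1 * (p t (x - 1) y - 2 * p t x y + p t (x + 1) y)).
Proof.
move=> Dx Dy t0; have [_ _ dp] := p_heat Dx Dy.
exact: (is_derive_even_ext t0 (dp t t0)).
Qed.

End heat_equation.

Lemma forward_diff_nat (R : realType) (f : int -> R) (x : nat) :
  forward_diff f x = f x.+1 - f x.
Proof. by rewrite /forward_diff -addn1 PoszD. Qed.

Lemma free_slope_const (R : realType) (c k W : nat -> R) (x : nat) :
  (forall z, (z <= x)%N -> c z = 1) -> (forall z, (0 < z <= x)%N -> k z = 0) ->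
  (forall y, generator c k W y = - (k 0%N * (y == 0%N)%:R)) ->
  W x.+1 - W x = W 1%N - W 0%N.
Proof.
move=> c1 k0 WE; elim: x c1 k0 => // x IHx c1 k0.
rewrite -IHx; last 2 first.
- by move=> z zx; apply: c1; exact: leqW.
- by move=> z /andP[z0 zx]; apply: k0; rewrite z0 leqW.
have := WE x.+1; rewrite /generator (c1 x.+1)// (c1 x)//= (k0 x.+1) ?leqnn//.
by rewrite mulr0 oppr0; lra.
Qed.

Lemma free_value (R : realType) (c k W : nat -> R) (x : nat) :
  (forall z, (z < x)%N -> c z = 1) -> (forall z, (0 < z < x)%N -> k z = 0) ->
  (forall y, generator c k W y = - (k 0%N * (y == 0%N)%:R)) ->
  W x = W 0%N + x%:R * (W 1%N - W 0%N).
Proof.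
move=> c1 k0 WE; elim: x c1 k0 => [|x IHx] c1 k0; first by rewrite mul0r addr0.
have := free_slope_const c1 k0 WE; have := IHx _ _.
move=> /(_ (fun z zx => c1 z (leqW zx))) => /(_ _) H.
have -> : W x = W 0%N + x%:R * (W 1%N - W 0%N).
  by apply: H => z /andP[z0 zx]; apply: k0; rewrite z0 ltnS ltnW.
by rewrite -natr1; lra.
Qed.


Lemma gradient_series_transfer (R : realType) (p : R -> int -> int -> R)
    (K : R -> nat -> nat -> R) (x xb y : nat) :
  (forall t : R, 0 <= t -> gradient K t x y = p t x.+1 y - p t x y) ->
  (forall t : R, 0 <= t -> gradient K t xb y = p t xb.+1 y - p t xb y) ->
  (@lebesgue_measure R).-integrable `[0, +oo[
    (EFin \o (fun t => gradient K t x y * gradient K t xb y)) ->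
  gradient_integrable p x xb y /\
  gradient_integral p x xb y = (\int[@lebesgue_measure R]_(t in `[0%R, +oo[)
    (gradient K t x y * gradient K t xb y))%R.
Proof.
move=> Kx Kxb intK.
have E (t : R) : t \in `[0, +oo[%classic ->
    gradient K t x y * gradient K t xb y = gradient_product p x xb y t.
  rewrite inE /= in_itv /= andbT => t0.
  by rewrite /gradient_product !forward_diff_nat Kx ?Kxb.
split; last by apply: eq_Rintegral => t /E ->.
by apply: (eq_integrable _ _ _ _ intK) => // t /E /= ->.
Qed.

Section half_line.
Variables (R : realType) (a : R) (p : R -> int -> int -> R).
Hypothesis a01 : 0 <= a <= 1.
Hypothesis p_robin : robin_kernel_half_line (1 - a) p.

(** The ghost value [(1 - a) * f 0] turns the Laplacian at 0 into [f 1 - f 0 - a * f 0]: the Robin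
    condition is killing with [k 0 = a]. *)
Definition half_line_killing (x : nat) : R := a * (x == 0%N)%:R.

Definition half_line_walk (t : R) (x y : nat) : R := p `|t| x y.

Lemma half_line_walk_kernel :
  birth_death_kernel (fun=> 1) half_line_killing half_line_walk.
Proof.
have [heat robin bnd] := p_robin.
have N0 (x : nat) : half_line x by [].
split.
- move=> x y; rewrite /half_line_walk normr0.
  by have [-> _ _] := heat x y (N0 x) (N0 y); rewrite eqz_nat.
- by move=> x y; exact: (continuous_heat_even heat).
- move=> t x y t0.
  have -> : 2^-1 *
        generator (fun=> 1) half_line_killing (half_line_walk t ^~ y) x =
      2^-1 * (p t (x%:Z - 1) y - 2 * p t x y + p t (x%:Z + 1) y).
    congr (_ * _); rewrite /generator /half_line_killing /half_line_walk.
    rewrite ger0_norm ?ltW//.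
    have -> : x%:Z + 1 = x.+1 by rewrite -addn1 PoszD.
    case: x => [|x] /=.
      by rewrite sub0r (robin t y (ltW t0) (N0 y)) mulr1; ring.
    by rewrite mulr0 (_ : x.+1%:Z - 1 = x); [ring|rewrite -addn1 PoszD addrK].
  exact: (is_derive_heat_even heat).
- move=> y T; have [M pM] := bnd y (N0 y); exists M => t x _.
  by rewrite /half_line_walk; exact: pM.
Qed.

Theorem half_line_gradient_series (x xb : nat) :
  (forall y : nat, gradient_integrable p x xb y) /\
  \sum_(0 <= y < n) gradient_integral p x xb y @[n --> \oo]
    --> ((x == xb)%:R : R).
Proof.
have one01 : 0 <= (1 : R) <= 1 by rewrite ler01 lexx.
have k01 z : 0 <= half_line_killing z <= 1.
  by rewrite /half_line_killing; case: (z == 0%N);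
    rewrite ?mulr1 ?mulr0 ?lexx ?ler01.
have [W [W01 WE WS]] := kernel_gradient_series (fun=> one01) k01
  half_line_walk_kernel.
have k0 z n : (0 < z <= n)%N -> half_line_killing z = 0.
  by case: z => // z _; rewrite /half_line_killing mulr0.
have fx z : free_edge (fun=> 1) half_line_killing z by split=> // u; exact: k0.
have slope z : W z.+1 - W z = W 1%N - W 0%N.
  by apply: free_slope_const WE => // u; exact: k0.
have value z : W z = W 0%N + z%:R * (W 1%N - W 0%N).
  apply: free_value WE => // u /andP[u0 _]; apply: (k0 u u).
  by rewrite u0 leqnn.
have W_le1 n : `|W n - W 0%N| <= 1.
  by rewrite ler_norml; have := W01 n; have := W01 0%N; lra.
have slope0 : W 1%N - W 0%N = 0.
  apply/eqP; apply: contraT => s0.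
  have s0' : 0 < `|W 1%N - W 0%N| by rewrite normr_gt0.
  have := archi_boundP (ltW (_ : 0 < `|W 1%N - W 0%N|^-1)).
  rewrite invr_gt0 => /(_ s0'); set n := Num.bound _.
  rewrite -[_^-1]mul1r ltr_pdivrMr// => n1.
  have := W_le1 n.
  by rewrite value addrC addKr normrM normr_nat leNgt n1.
have [intg lim] := WS x xb (fx x) (fx xb).
rewrite slope slope0 addr0 in lim.
have tr (y : nat) : gradient_integrable p x xb y /\
    gradient_integral p x xb y = (\int[@lebesgue_measure R]_(t in `[0%R, +oo[)
    (gradient half_line_walk t x y * gradient half_line_walk t xb y))%R.
  by apply: gradient_series_transfer (intg y) => t t0;
    rewrite /gradient /half_line_walk ger0_norm.
split=> [y|]; first by have [] := tr y.
rewrite (_ : (fun n => _) = (fun n => \sum_(0 <= y < n)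
    (\int[@lebesgue_measure R]_(t in `[0%R, +oo[)
      (gradient half_line_walk t x y * gradient half_line_walk t xb y))%R)) //.
by apply/funext => n; apply: eq_bigr => y _; have [] := tr y.
Qed.

End half_line.

(** * The segment *)

Lemma bounded_on_itv (R : realType) (f : R -> R) (T : R) : continuous f ->
  exists M : R, forall t, 0 <= t <= T -> `|f t| <= M.
Proof.
move=> cf; have [T0|T0] := leP 0 T; last by exists 0 => t tT; exfalso; lra.
have cnf : {within `[0, T], continuous (fun t => `|f t|)}.
  apply: continuous_subspaceT => t.
  apply: (@continuous_comp _ _ _ f Num.norm); first exact: cf.
  exact: norm_continuous.
have [c _ fc] := EVT_max T0 cnf.
by exists `|f c| => t tT; apply: fc; rewrite in_itv.
Qed.

Section segment.
Variables (R : realType) (N : nat) (a b : R) (p : R -> int -> int -> R).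
Hypothesis N_gt0 : (0 < N)%N.
Hypothesis a01 : 0 <= a <= 1.
Hypothesis b01 : 0 <= b <= 1.
Hypothesis p_robin : robin_kernel_segment N (1 - a) (1 - b) p.

Definition segment_conductance (x : nat) : R := (x < N)%:R.

Definition segment_killing (x : nat) : R :=
  a * (x == 0%N)%:R + b * (x == N)%:R.

(* The sites beyond [N] are isolated points of the birth-death chain. *)
Definition segment_walk (t : R) (x y : nat) : R :=
  if (x <= N)%N && (y <= N)%N then p `|t| x y else (x == y)%:R.

Lemma segment_killing0 : segment_killing 0%N = a.
Proof.
by rewrite /segment_killing eqxx (ltn_eqF N_gt0) mulr1 mulr0 addr0.
Qed.

Lemma segment_killing_interior x : (0 < x < N)%N -> segment_killing x = 0.
Proof.
move=> /andP[x0 xN].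
by rewrite /segment_killing (gtn_eqF x0) (ltn_eqF xN) !mulr0 addr0.
Qed.

Lemma segment_killing_last : segment_killing N = b.
Proof. by rewrite /segment_killing eqxx (gtn_eqF N_gt0) mulr0 mulr1 add0r. Qed.

Lemma segment_conductance_lt x : (x < N)%N -> segment_conductance x = 1.
Proof. by rewrite /segment_conductance => ->. Qed.

Lemma segment_conductance_last : segment_conductance N = 0.
Proof. by rewrite /segment_conductance ltnn. Qed.

Lemma segment_nat x : segment N (Posz x) <-> (x <= N)%N.
Proof. by rewrite /segment /= lez_nat. Qed.

Lemma generator_segment (f : nat -> R) (g : int -> R) (x : nat) :
  (x <= N)%N -> g (-1) = (1 - a) * g 0 -> g (N%:Z + 1) = (1 - b) * g N ->
  (forall z, (z <= N)%N -> f z = g z) ->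
  generator segment_conductance segment_killing f x =
  g (x%:Z - 1) - 2 * g x + g (x%:Z + 1).
Proof.
move=> xN g0 gN fg; rewrite /generator.
have predE z : (0 < z)%N -> z%:Z - 1 = z.-1.
  by case: z => // z _; rewrite -addn1 PoszD addrK addn1.
have succE z : z%:Z + 1 = z.+1 by rewrite -addn1 PoszD.
have [x0|x0] := eqVneq x 0%N.
  rewrite x0 segment_killing0 segment_conductance_lt// !fg//=.
  by rewrite sub0r g0 add0r; ring.
have [->|xN'] := eqVneq x N.
  rewrite segment_killing_last segment_conductance_last gN.
  rewrite segment_conductance_lt ?prednK// mul0r !fg ?leq_pred// predE//.
  by ring.
have xN1 : (x < N)%N by rewrite ltn_neqAle xN'.
rewrite segment_killing_interior ?lt0n ?x0// !segment_conductance_lt//;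
  last by rewrite (leq_ltn_trans (leq_pred x)).
rewrite !fg// ?(leq_trans (leq_pred x))// succE predE ?lt0n//; ring.
Qed.

Lemma generator_segment_isolated (t : R) (x y : nat) :
  ~~ ((x <= N)%N && (y <= N)%N) ->
  generator segment_conductance segment_killing (segment_walk t ^~ y) x = 0.
Proof.
rewrite negb_and -!ltnNge /generator.
have [Nx _|xN /= Ny] := ltnP N x.
  rewrite /segment_killing /segment_conductance.
  rewrite (gtn_eqF Nx) (gtn_eqF (ltn_trans N_gt0 Nx)).
  have -> : (x < N)%N = false by lia.
  have -> : (x.-1 < N)%N = false by lia.
  by rewrite /=; ring.
have out z : segment_walk t z y = (z == y)%:R.
  by rewrite /segment_walk [(y <= N)%N]leqNgt Ny andbF.
have xy z : (z <= N)%N -> (z == y) = false.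
  by move=> zN; rewrite ltn_eqF// (leq_ltn_trans zN).
rewrite !out (xy x)// (xy x.-1) ?(leq_trans (leq_pred x))//.
rewrite /segment_conductance.
have [xN'|Nx] := ltnP x N; first by rewrite (xy x.+1)//= mulr0n; ring.
by rewrite /= mulr0n mul0r; ring.
Qed.

Lemma segment_walk_kernel :
  birth_death_kernel segment_conductance segment_killing segment_walk.
Proof.
have [heat robin] := p_robin.
have cW (x y : nat) : continuous (fun t => segment_walk t x y).
  rewrite /segment_walk; case: andP => [[xN yN]|_]; last exact: continuous_cst.
  by apply: (continuous_heat_even heat); exact/segment_nat.
split=> // [x y|t x y t0|y T].
- rewrite /segment_walk normr0; case: andP => // -[xN yN].
  have [-> _ _] := heat x y (proj2 (segment_nat x) xN)
    (proj2 (segment_nat y) yN).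
  by rewrite eqz_nat.
- have [/andP[xN yN]|outside] := boolP ((x <= N)%N && (y <= N)%N); last first.
    rewrite (_ : (fun s => segment_walk s x y) = cst ((x == y)%:R)); last first.
      by apply/funext => s; rewrite /segment_walk (negPf outside).
    rewrite (generator_segment_isolated t outside) mulr0; exact: is_derive_cst.
  rewrite (_ : (fun s => segment_walk s x y) = fun s => p `|s| x y); last first.
    by apply/funext => s; rewrite /segment_walk xN yN.
  have [g0 gN] := robin t y (ltW t0) (proj2 (segment_nat y) yN).
  rewrite (@generator_segment _ (fun z => p t z y) _ xN g0 gN); last first.
    by move=> z zN; rewrite /segment_walk zN yN ger0_norm// ltW.
  by apply: (is_derive_heat_even heat) => //; exact/segment_nat.
- have [M WM] : exists M : R, forall t x, (x <= N)%N -> 0 <= t <= T ->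
      `|segment_walk t x y| <= M.
    (* Induction on the number of sites covered by the bound, the walk itself staying on the segment
       of length [N]. *)
    elim: (N) => [|n [M WM]].
      have [M WM] := bounded_on_itv T (cW 0%N y).
      by exists M => t x; rewrite leqn0 => /eqP ->; exact: WM.
    have [M' WM'] := bounded_on_itv T (cW n.+1 y).
    exists (Num.max M M') => t x; rewrite leq_eqVlt => /predU1P[->|xn] tT.
      by rewrite le_max WM' ?orbT.
    by rewrite le_max WM.
  exists (Num.max M 1) => t x tT; rewrite le_max.
  have [xN|Nx] := leqP x N; first by rewrite WM.
  rewrite /segment_walk [(x <= N)%N]leqNgt Nx /= normr_nat.
  by rewrite lern1 leq_b1 orbT.
Qed.


(** For positive [a] and [b] this is the conductance of the resistances [1 / a], [N] and [1 / b] in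
    series. For [a = b = 0] the quotient is [0 / 0], which is 0 by convention and is the right
    value. *)
Definition segment_defect : R := a * b / (a + b + N%:R * (a * b)).

Theorem segment_gradient_sum (x xb : nat) : (x < N)%N -> (xb < N)%N ->
  (forall y : nat, (y <= N)%N -> gradient_integrable p x xb y) /\
  \sum_(0 <= y < N.+1) gradient_integral p x xb y =
    (x == xb)%:R - segment_defect.
Proof.
move=> xN xbN.
have /andP[a0 a1] := a01; have /andP[b0 b1] := b01.
have c01 z : 0 <= segment_conductance z <= 1.
  by rewrite /segment_conductance; case: (z < N)%N; rewrite ?lexx ?ler01.
have k01 z : 0 <= segment_killing z <= 1.
  have [->|z0] := eqVneq z 0%N; first by rewrite segment_killing0.
  rewrite /segment_killing (negPf z0) mulr0 add0r.
  by case: (z == N); rewrite ?mulr0 ?mulr1 ?lexx ?ler01.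
have [W [W01 WE WS]] := kernel_gradient_series c01 k01 segment_walk_kernel.
have k0 z n : (n < N)%N -> (0 < z <= n)%N -> segment_killing z = 0.
  move=> nN /andP[z0 zn].
  by rewrite segment_killing_interior// z0 (leq_ltn_trans zn).
have c1 z n : (n < N)%N -> (z <= n)%N -> segment_conductance z = 1.
  by move=> nN zn; rewrite segment_conductance_lt// (leq_ltn_trans zn).
have fx z : (z < N)%N -> free_edge segment_conductance segment_killing z.
  by move=> zN; split=> [|u]; [exact: (c1 z z)|exact: k0].
have slope z : (z < N)%N -> W z.+1 - W z = W 1%N - W 0%N.
  move=> zN; apply: free_slope_const WE => u; [exact: c1|exact: k0].
have valueN : W N = W 0%N + N%:R * (W 1%N - W 0%N).
  apply: free_value WE => u; [exact: segment_conductance_lt|].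
  exact: segment_killing_interior.
have slopeN : W N - W N.-1 = W 1%N - W 0%N.
  by rewrite -(slope N.-1) ?prednK.
have eq0 := WE 0%N; have eqN := WE N.
have slopeE : W 1%N - W 0%N = - segment_defect.
  move: eq0 eqN; rewrite /generator segment_killing0 segment_killing_last.
  rewrite segment_conductance_last !segment_conductance_lt ?prednK//.
  rewrite (gtn_eqF N_gt0) slopeN valueN /= subrr.
  set s := W 1%N - W 0%N => eq0 eqN.
  (* The equations at the two ends read [s = a * W 0 - a] and [- s = b * W N], with
     [W N = W 0 + N * s]; eliminating [W 0] determines [s]. *)
  have E : s * (a + b + N%:R * (a * b)) = - (a * b).
    have aW : a * W 0%N = s + a by lra.
    have bW : b * (W 0%N + N%:R * s) = - s by lra.
    have := congr1 (fun u => b * u) aW; have := congr1 (fun u => a * u) bW.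
    rewrite /=; lra.
  rewrite /segment_defect; have Nab : 0 <= N%:R * (a * b) by rewrite !mulr_ge0.
  (* A zero denominator forces [a = 0], and then the equation at 0 gives slope 0. *)
  have [d0|d0] := eqVneq (a + b + N%:R * (a * b)) 0.
    have az : a = 0 by lra.
    by move: eq0; rewrite az !mul0r oppr0; lra.
  by apply: (mulIf d0); rewrite E mulNr divfK.
have [intg lim] := WS x xb (fx x xN) (fx xb xbN).
rewrite slope// slopeE in lim.
have tr (y : nat) : (y <= N)%N -> gradient_integrable p x xb y /\
    gradient_integral p x xb y = (\int[@lebesgue_measure R]_(t in `[0%R, +oo[)
    (gradient segment_walk t x y * gradient segment_walk t xb y))%R.
  move=> yN; apply: gradient_series_transfer (intg y) => t t0;
  by rewrite /gradient /segment_walk ger0_norm// yN ?xN ?xbN ?(ltnW xN)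
    ?(ltnW xbN).
split=> [y yN|]; first by have [] := tr y yN.
(* The terms with [y > N] vanish, as the walk never connects those sites to the segment; the series
   is a finite sum. *)
apply: cvgn_uniq lim; apply: cvg_near_cst; near=> n.
have Nn : (N.+1 <= n)%N by near: n; exact: nbhs_infty_ge.
rewrite (big_cat_nat (leq0n N.+1) Nn) /= [X in _ + X]big1_seq ?addr0.
  rewrite !big_mkord; apply: eq_bigr => y _; have [|_ ->//] := tr y.
  by rewrite -ltnS.
move=> y /andP[_]; rewrite mem_index_iota => /andP[Ny _].
rewrite /Rintegral integral0_eq// => t _.
have out z : (z < N)%N -> gradient segment_walk t z y = 0.
  move=> zN; rewrite /gradient /segment_walk [(y <= N)%N]leqNgt Ny !andbF.
  have zy := leq_ltn_trans zN Ny.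
  by rewrite !ltn_eqF ?subrr// ltnW.
by rewrite !out// mul0r.
Unshelve. all: by end_near. Qed.

End segment.

(** * Size of the defect, and the two domains together *)

Lemma segment_defect_ge0 (R : realType) (N : nat) (a b : R) :
  0 <= a -> 0 <= b -> 0 <= segment_defect N a b.
Proof. by move=> a0 b0; rewrite divr_ge0 ?addr_ge0 ?mulr_ge0. Qed.

Lemma segment_defect_le (R : realType) (N : nat) (a b : R) :
  (0 < N)%N -> 0 <= a -> 0 <= b -> segment_defect N a b <= N%:R^-1.
Proof.
move=> N0 a0 b0; have N0' : 0 < N%:R :> R by rewrite ltr0n.
have Nab : 0 <= N%:R * (a * b) by rewrite !mulr_ge0.
rewrite /segment_defect; have [->|d0] := eqVneq (a + b + N%:R * (a * b)) 0.
  by rewrite invr0 mulr0 invr_ge0 ltW.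
rewrite ler_pdivrMr; last by rewrite lt_neqAle eq_sym d0 !addr_ge0.
by rewrite ler_pdivlMl//; lra.
Qed.

Theorem proposition5p1 (R : realType) (A B : R) (hA : 0 <= A) (hB : 0 <= B) :
  (exists C : R, 0 < C /\
    \forall N \near \oo,
      let eps : R := N%:R^-1 in
      let muA := 1 - eps * A in
      let muB := 1 - eps * B in
      exists c : R,
        [/\ 0 <= c <= C * eps,
            muA = 1 \/ muB = 1 -> c = 0 &
            forall p : R -> int -> int -> R, robin_kernel_segment N muA muB p ->
            forall x xb : nat, (x < N)%N -> (xb < N)%N ->
              (forall y : nat, (y <= N)%N -> gradient_integrable p x xb y) /\
              \sum_(0 <= y < N.+1) gradient_integral p x xb y =
              (x == xb)%:R * (1 - c) - (x != xb)%:R * c])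
  /\
  (\forall eps \near (0 : R)^'+,
    forall p : R -> int -> int -> R,
      robin_kernel_half_line (1 - eps * A) p ->
      forall x xb : nat,
        (forall y : nat, gradient_integrable p x xb y) /\
        \sum_(0 <= y < n) gradient_integral p x xb y @[n --> \oo]
          --> ((x == xb)%:R : R)).
Proof.
split.
  (* [C = 1] because [segment_defect_le] bounds the defect by [N%:R^-1], that is [eps]. Taking [N]
     above [A] and [B] makes both killing parameters at most 1. *)
  exists 1; split=> //; near=> N; set eps : R := N%:R^-1.
  have N0 : (0 < N)%N by near: N; exact: nbhs_infty_gt.
  have NA : A <= N%:R by near: N; exact: nbhs_infty_ger.
  have NB : B <= N%:R by near: N; exact: nbhs_infty_ger.
  have N0' : 0 < N%:R :> R by rewrite ltr0n.
  have e0 : 0 < eps by rewrite invr_gt0.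
  have a01 : 0 <= eps * A <= 1.
    by rewrite mulr_ge0 ?(ltW e0)//= ler_pdivrMl// mulr1.
  have b01 : 0 <= eps * B <= 1.
    by rewrite mulr_ge0 ?(ltW e0)//= ler_pdivrMl// mulr1.
  have /andP[a0 _] := a01; have /andP[b0 _] := b01.
  exists (segment_defect N (eps * A) (eps * B)); split.
  - by rewrite segment_defect_ge0//= mul1r segment_defect_le.
  - rewrite /segment_defect => -[] mu1.
      have -> : eps * A = 0 by lra.
      by rewrite !mul0r.
    have -> : eps * B = 0 by lra.
    by rewrite mulr0 mul0r.
  - move=> p p_robin x xb xN xbN.
    have [intg ->] := segment_gradient_sum N0 a01 b01 p_robin xN xbN.
    split=> //; case: (x == xb) => /=; ring.
near=> eps => p p_robin x xb.
have e0 : 0 < eps by near: eps; exact: nbhs_right_gt.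
(* [A + 1] instead of [A], since [A] may be 0; this still gives [eps * A <= 1]. *)
have eA : eps <= (A + 1)^-1.
  by near: eps; apply: nbhs_right_le; rewrite invr_gt0; lra.
apply: (half_line_gradient_series _ p_robin).
rewrite mulr_ge0 ?(ltW e0)//=.
have A1 : 0 < A + 1 by lra.
move: eA; rewrite -(ler_pM2r A1) mulVf ?gt_eqF//; nra.
Unshelve. all: by end_near. Qed.
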